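(* Let $N\ge2$, $\Omega=\mathbb{R}^{N-1}\times(0,\infty)$, $(\phi,\psi)\in L^p(\Omega)\times L^p(\partial\Omega)$ with $p\in[1,\infty)$, and fix $\epsilon>0$, $\delta>0$. With $u_k$, $z^D$, $f_p$ as in the context, for every $R>0$, \[\sup_{(x,t)\in Q(R)}|u_k(x,t)-z^D(x,t)|=O(f_p(k))\quad\text{as }k\to\infty.\]
   Context: $x=(x',x_N)$, $\partial\Omega\cong\mathbb{R}^{N-1}$ with surface measure $d\sigma$, $\Delta'$ the Laplacian in $x'$. $\Gamma_d(x,t)=(4\pi t)^{-d/2}e^{-|x|^2/(4t)}$, $\partial_\xi\Gamma_1$ the spatial derivative of $\Gamma_1$, $y^*=(y',-y_N)$, $G_0(x,y,s)=\Gamma_N(x-y,s)-\Gamma_N(x-y^*,s)$. For $k>0$: $H(x,y,t)=-2\int_0^t\Gamma_{N-1}(x'-y',\frac{t-\tau}\epsilon+\frac k\delta\tau)\partial_\xi\Gamma_1(x_N+y_N+\frac\tau\delta,\frac{t-\tau}\epsilon)d\tau$, $G=G_0(x,y,t/\epsilon)+\delta^{-1}H$, $u_k(x,t)=\int_\Omega G(x,y,t)\phi(y)dy+\frac\delta\epsilon\int_{\partial\Omega}G(x,y,t)\psi(y)d\sigma(y)$ (solution of $\epsilon\partial_tu=\Delta u$ in $\Omega$, $\delta\partial_tu-k\Delta'u-\partial_{x_N}u=0$ on $\partial\Omega$, initial data $(\phi,\psi)$). $z^D(x,t)=\int_\Omega G_0(x,y,t/\epsilon)\phi(y)dy$. $Q(R)=\{(x,t)\in\overline\Omega\times(0,\infty):x_N+t>R\}$.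 With $p_N=(N-1)/2$, $f_p(r)=r^{-1}$ if $p<p_N$, $r^{-1}\log r$ if $p=p_N$, $r^{-\frac{N-1}{2p}}$ if $p>p_N$, for $r>1$. *)

(* Defs.v *)
From HB Require Import structures.
From mathcomp Require Import all_boot all_order all_algebra.
From mathcomp Require Import all_classical all_reals all_analysis.
Set Implicit Arguments. Unset Strict Implicit. Unset Printing Implicit Defensive.
Import Order.TTheory GRing.Theory Num.Theory.
Import numFieldNormedType.Exports.
Local Open Scope classical_set_scope.
Local Open Scope ring_scope.

Section defs.
Variable R : realType.

Fixpoint iint (n : nat) : (n.-tuple R -> \bar R) -> \bar R :=
  match n return (n.-tuple R -> \bar R) -> \bar R with
  | 0 => fun f => f [tuple]
  | m.+1 => fun f =>
      (\int[@lebesgue_measure R]_(x in [set: R]) iint (fun v => f (cons_tuple x v)))%E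
  end.

Definition dist2 n (a b : n.-tuple R) : R :=
  \sum_(i < n) (tnth a i - tnth b i) ^+ 2.

(* heat kernel Gamma_d, given |x|^2 = r2 :
   (4 pi t)^(-d/2) exp(-|x|^2/(4t)) *)
Definition gauss (d : nat) (r2 t : R) : R :=
  powR (4 * pi * t) (- (d%:R / 2)) * expR (- (r2 / (4 * t))).

(* spatial derivative of Gamma_1 : d/dxi Gamma_1(xi,t) = -xi/(2t) Gamma_1(xi,t) *)
Definition dgauss1 (xi t : R) : R := - (xi / (2 * t)) * gauss 1 (xi ^+ 2) t.

(* points of the closure of Omega = R^(N-1) x (0,oo) : pairs (x', x_N) *)
Definition pt N := ((N.-1).-tuple R * R)%type.

(* G_0(x,y,s) = Gamma_N(x-y,s) - Gamma_N(x-y*,s) *)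
Definition G0 N (x y : pt N) (s : R) : R :=
  gauss N (dist2 x.1 y.1 + (x.2 - y.2) ^+ 2) s
  - gauss N (dist2 x.1 y.1 + (x.2 + y.2) ^+ 2) s.

Definition Hk N (eps delta k : R) (x y : pt N) (t : R) : \bar R :=
  ((-2)%:E * \int[@lebesgue_measure R]_(tau in [set tau : R | (0 <= tau <= t)%R])
      (gauss N.-1 (dist2 x.1 y.1) ((t - tau) / eps + k / delta * tau)
       * dgauss1 (x.2 + y.2 + tau / delta) ((t - tau) / eps))%R%:E)%E.

Definition Gk N (eps delta k : R) (x y : pt N) (t : R) : \bar R :=
  ((G0 x y (t / eps))%:E + (delta^-1)%:E * Hk eps delta k x y t)%E.

Definition int_Omega N (f : pt N -> \bar R) : \bar R :=
  iint (fun y' => \int[@lebesgue_measure R]_(yN in [set yN : R | (0 < yN)%R]) f (y', yN))%E.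

(* integral over the boundary R^(N-1) x {0} (surface measure = Lebesgue on R^(N-1)) *)
Definition int_bd N (f : (N.-1).-tuple R -> \bar R) : \bar R := iint f.

Definition Lp_Omega N (p : R) (phi : pt N -> R) : Prop :=
  measurable_fun [set y : pt N | 0 < y.2] phi /\
  (int_Omega (fun y => (`| phi y | `^ p)%:E) < +oo)%E.

Definition Lp_bd N (p : R) (psi : (N.-1).-tuple R -> R) : Prop :=
  measurable_fun [set: (N.-1).-tuple R] psi /\
  (int_bd (fun y => (`| psi y | `^ p)%:E) < +oo)%E.

Definition u_k N (eps delta k : R) (phi : pt N -> R) (psi : (N.-1).-tuple R -> R)
  (x : pt N) (t : R) : \bar R :=
  (int_Omega (fun y => Gk eps delta k x y t * (phi y)%:E)
   + (delta / eps)%:E * int_bd (fun y' => Gk eps delta k x (y', 0%R) t * (psi y')%:E))%E.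

Definition zD N (eps : R) (phi : pt N -> R) (x : pt N) (t : R) : \bar R :=
  int_Omega (fun y => (G0 x y (t / eps))%:E * (phi y)%:E)%E.

Definition inQ N (Rr : R) (x : pt N) (t : R) : Prop :=
  0 <= x.2 /\ 0 < t /\ Rr < x.2 + t.

Definition fp (N : nat) (p r : R) : R :=
  let pN := (N.-1)%:R / 2 in
  if p < pN then r^-1
  else if p == pN then r^-1 * ln r
  else powR r (- ((N.-1)%:R / (2 * p))).

End defs.

(* Main.v *)
Require Import Defs.
From HB Require Import structures.
From mathcomp Require Import all_boot all_order all_algebra.
From mathcomp Require Import all_classical all_reals all_analysis.
From mathcomp Require Import measurable_realfun.
From mathcomp Require Import lebesgue_integral_fubini normal_distribution.
From mathcomp Require Import ring lra.
Set Implicit Arguments.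
Unset Strict Implicit.
Unset Printing Implicit Defensive.
Import Order.TTheory GRing.Theory Num.Theory.
Import numFieldNormedType.Exports.
Local Open Scope classical_set_scope.
Local Open Scope ring_scope.

(* Write [s = (t - tau) / eps], [xi = x_N + y_N + tau / delta],
   [sigma = s + k tau / delta] and [a = (N - 1) / (2 p)].  Since [G_0]
   vanishes for [y_N = 0], the difference [u_k - z^D] is an integral of the
   nonnegative layer kernel [H] against [phi] and [psi].  On [Q(R)] the sum
   [xi + s] is bounded below, and this gives
     [sigma^(-a) |dGamma_1(xi, s)| <= C (1 + k tau)^(-a) (1 + y_N + tau)^(-2)].
   Instead of Hoelder's inequality, [|phi| <= A + A^(1-p) |phi|^p] is used with
   [A = sigma^(-a) (1 + y_N + tau)^(-1/p)]; after Tonelli and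
   [int Gamma_(N-1) = 1], the difference is at most a constant times
   [int_0^oo (1 + k tau)^(-a) (1 + tau)^(-1-1/(2p)) dtau], which is [O(f_p(k))].
   The iterated integrals of the definitions are integrals against
   sigma-finite measures, so the usual integration theory applies to them. *)

(** The powers of Z = 1 + y_N + tau form a budget. The kernel bound supplies Z^(-2), and the power
    Z^(-1/p) inside A distributes it so that both terms of the inequality stay integrable. With q =
    1 + 1/(2p), the term A receives Z^(-2-1/p) = Z^(-q) Z^(-q), one factor for the tau integral and
    one for the y_N integral; the term with |phi|^p receives Z^(-1-1/p) and needs decay in tau only.
    This treats p = 1 together with p > 1, where Hoelder's inequality would ask for a separate
    supremum norm. The delicate region is tau near t, where s tends to 0: there the factor dGamma_1
    blows up only if xi tends to 0 as well, and Q(R) excludes this. All dependence on k sits in (1 +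
    k tau)^(-a), whose integral near tau = 0 produces the three regimes of f_p according to the
    position of a relative to 1. *)

(** * Iterated integrals as integrals against sigma-finite measures *)

(** Tonelli and Fubini expect sigma-finiteness as part of the structure of the measure, so a proof
    of it is packed into a new measure that agrees with [m] on every set. *)
Lemma measure_to_sigma_finite d (T : measurableType d) (R : realType)
  (m : {measure set T -> \bar R}) : sigma_finite setT m ->
  exists mu : {sigma_finite_measure set T -> \bar R}, forall A, mu A = m A.
Proof.
move=> sf.
pose H1 := isSFinite.Build _ _ _ _ (sfinite_measure_sigma_finite sf).
pose H2 := isSigmaFinite.Build _ _ _ _ sf.
pose mu : {sigma_finite_measure set T -> \bar R} :=
  HB.pack_for (SigmaFiniteMeasure.type T R) (Measure.sort m) H1 H2.
by exists mu.
Qed.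

Lemma pushforward_sigma_finite d d' (X : measurableType d) (Y : measurableType d')
  (R : realType) (mu : {sigma_finite_measure set X -> \bar R})
  (f : X -> Y) (g : Y -> X) :
  measurable_fun setT f -> measurable_fun setT g -> cancel f g ->
  exists nu : {sigma_finite_measure set Y -> \bar R},
    forall A, nu A = pushforward mu f A.
Proof.
move=> mf mg fg.
pose m : {measure set Y -> \bar R} :=
  measure_function_pushforward__canonical__measure_function_Measure mu mf.
apply: (measure_to_sigma_finite (m := m)).
have [F FT Foo] := sigma_finiteT mu.
exists (fun i => g @^-1` F i).
  by rewrite -preimage_bigcup -FT.
move=> i; have [mF Fi] := Foo i; split.
  by rewrite -[X in measurable X]setTI; exact: mg.
rewrite /m /= /pushforward.
suff -> : f @^-1` (g @^-1` F i) = F i by [].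
by apply/seteqP; split => x /=; rewrite fg.
Qed.

(** Integrability is not assumed: the integral is the difference of those of f^+ and f^-, each
    measurable in the parameter by Tonelli, and subtraction on the extended reals is total and
    measurable. *)
Lemma measurable_fun_integral_param d d' (S : measurableType d)
  (T : measurableType d') (R : realType)
  (mu : {sigma_finite_measure set T -> \bar R}) (f : S * T -> \bar R) :
  measurable_fun setT f ->
  measurable_fun setT (fun s => \int[mu]_t f (s, t))%E.
Proof.
move=> mf.
under eq_fun do rewrite integralE.
apply: emeasurable_funB.
- under eq_fun do under eq_integral do rewrite funepos_comp/=.
  apply: (measurable_fun_fubini_tonelli_F (f^\+)%E) => //.
  exact: measurable_funepos.
- under eq_fun do under eq_integral do rewrite funeneg_comp/=.
  apply: (measurable_fun_fubini_tonelli_F (f^\-)%E) => //.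
  exact: measurable_funeneg.
Qed.

(* For a signed integrable function the inner integral of an iterated integral
   is junk on a null set; [repr_measurable] makes it measurable all the same,
   which the almost-everywhere argument in [integral_repr_prod] requires. *)
Record integral_repr d (T : measurableType d) (R : realType)
  (L : (T -> \bar R) -> \bar R) (mu : {sigma_finite_measure set T -> \bar R})
  : Prop := IntegralRepr {
  repr_ge0 : forall f, measurable_fun setT f -> (forall x, (0 <= f x)%E) ->
    L f = (\int[mu]_x f x)%E ;
  repr_integrable : forall f, mu.-integrable setT f -> L f = (\int[mu]_x f x)%E ;
  repr_measurable : forall d' (S : measurableType d') (f : S * T -> \bar R),
    measurable_fun setT f -> measurable_fun setT (fun s => L (fun t => f (s, t))) }.

Lemma integral_repr_integral d (T : measurableType d) (R : realType)
  (mu : {sigma_finite_measure set T -> \bar R}) :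
  @integral_repr d T R (fun f => \int[mu]_x f x)%E mu.
Proof. by split=> // d' S f; exact: measurable_fun_integral_param. Qed.

Lemma sigma_finite_product d1 d2 (T1 : measurableType d1)
  (T2 : measurableType d2) (R : realType)
  (m1 : {sigma_finite_measure set T1 -> \bar R})
  (m2 : {sigma_finite_measure set T2 -> \bar R}) :
  exists mu : {sigma_finite_measure set (T1 * T2)%type -> \bar R},
    forall A, mu A = (m1 \x m2)%E A.
Proof.
pose m : {measure set (T1 * T2)%type -> \bar R} := (m1 \x m2)%E.
apply: (measure_to_sigma_finite (m := m)).
have /sigma_finiteP[F [TF ndF Foo]] := sigma_finiteT m1.
have /sigma_finiteP[G [TG ndG Goo]] := sigma_finiteT m2.
exists (fun n => F n `*` G n).
  rewrite -setXTT TF TG; apply/seteqP; split => -[x y].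
    move=> [/= [n _ Fnx] [k _ Gky]]; exists (maxn n k) => //; split.
      by move: x Fnx; exact/subsetPset/ndF/leq_maxl.
    by move: y Gky; exact/subsetPset/ndG/leq_maxr.
  by move=> [n _ []/= ? ?]; split; exists n.
move=> k; have [mF Fk] := Foo k; have [mG Gk] := Goo k.
split; first exact: measurableX.
by rewrite /m /= product_measure1E// lte_mul_pinfty// ge0_fin_numE.
Qed.

(** The equality with the product measure is exported as well, because [integral_gauss_tensor] later
    needs Tonelli for this very measure. *)
Lemma integral_repr_prod d1 d2 (T1 : measurableType d1) (T2 : measurableType d2)
  (R : realType) L1 L2 (m1 : {sigma_finite_measure set T1 -> \bar R})
  (m2 : {sigma_finite_measure set T2 -> \bar R}) :
  integral_repr L1 m1 -> integral_repr L2 m2 ->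
  exists mu : {sigma_finite_measure set (T1 * T2)%type -> \bar R},
    integral_repr (fun f => L1 (fun x => L2 (fun y => f (x, y)))) mu /\
    forall A, mu A = (m1 \x m2)%E A.
Proof.
move=> r1 r2; have [mu muE] := sigma_finite_product m1 m2.
exists mu; split => //.
have E f : (\int[mu]_x f x = \int[m1 \x m2]_x f x)%E.
  by apply: eq_measure_integral => A mA _; exact: muE.
split.
- move=> f mf f0.
  rewrite E fubini_tonelli1// (_ : (fun x => _) = fubini_F m2 f).
    apply: (repr_ge0 r1).
      exact: measurable_fun_fubini_tonelli_F.
    by move=> x; exact: integral_ge0.
  apply/funext => x; apply: (repr_ge0 r2) => //.
  exact: measurableT_comp.
- move=> f /integrableP[mf]; rewrite E => foo.
  have intf : (m1 \x m2)%E.-integrable setT f by exact/integrableP.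
  rewrite E.
  set F := fun x => _.
  have mF : measurable_fun setT F by exact: (repr_measurable r2).
  have mG : measurable_fun setT (fubini_F m2 f) by exact: measurable_fubini_F intf.
  (* By Fubini almost every section is integrable, and there [L2] is the integral; the remaining
     sections form a null set, on which [F] only has to be measurable. *)
  have FG : ae_eq m1 setT (fubini_F m2 f) F.
    have := ae_integrable1 intf.
    apply: filterS => x /= ix _.
    by rewrite /F (repr_integrable r2).
  rewrite -integral12_prod_meas1//.
  rewrite (repr_integrable r1).
    by apply/esym/ae_eq_integral.
  apply/integrableP; split => //.
  have /integrableP[_] := integrable_fubini_F intf.
  congr (_ < _)%E; apply: ge0_ae_eq_integral => //.
  - exact: measurableT_comp.
  - exact: measurableT_comp.
  - by apply: filterS FG => x /= e _; rewrite e.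
- move=> d' S f mf.
  apply: (repr_measurable r1 (f := fun p => L2 (fun y => f (p.1, (p.2, y))))).
  apply: (repr_measurable r2 (f := fun p => f (p.1.1, (p.1.2, p.2)))).
  apply: (measurableT_comp mf).
  apply: measurable_fun_pair; first exact: measurableT_comp.
  by apply: measurable_fun_pair => //; exact: measurableT_comp.
Qed.

Lemma integral_repr_iint (R : realType) n :
  exists mu : {sigma_finite_measure set (n.-tuple R) -> \bar R},
    integral_repr (@iint R n) mu.
Proof.
elim: n => [|n [mu rmu]].
  (* The 0-fold iterated integral is evaluation at the empty tuple, that is, integration against its
     Dirac mass. *)
  pose mu : {sigma_finite_measure set (0.-tuple R) -> \bar R} :=
    dirac_measure_dirac__canonical__measure_function_SigmaFiniteMeasure
      R ([tuple] : 0.-tuple R).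
  have E (f : 0.-tuple R -> \bar R) : (\int[mu]_x f x = f [tuple])%E.
    rewrite integral_dirac // ?diracT ?mul1e //.
    rewrite (_ : f = cst (f [tuple])) //.
    by apply/funext => x; rewrite tuple0.
  exists mu; split => [f _ _|f _|d' S f mf]/=.
  - by rewrite E.
  - by rewrite E.
  - apply: (measurableT_comp mf).
    exact: measurable_fun_pair.
have [nu [rnu nuE]] := integral_repr_prod (integral_repr_integral
  (@lebesgue_measure R)) rmu.
(* The product measure is carried to (n+1)-tuples by [f]; head and tail provide the measurable left
   inverse that sigma-finiteness of the image requires. *)
pose f (p : R * n.-tuple R) := cons_tuple p.1 p.2.
pose g (v : n.+1.-tuple R) := (thead v, [tuple of behead v]).
have mf : measurable_fun setT f by exact: measurable_cons.
have mg : measurable_fun setT g.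
  apply: measurable_fun_pair; last exact: measurable_behead.
  exact: measurable_tnth.
have fg : cancel f g.
  move=> [x v]; rewrite /f /g /=; congr pair.
  by apply/val_inj.
have [mu' muE] := pushforward_sigma_finite nu mf mg fg.
exists mu'.
have E1 h : (\int[mu']_x h x = \int[pushforward nu f]_x h x)%E.
  by apply: eq_measure_integral => A mA _; exact: muE.
split.
- move=> h mh h0; rewrite E1 ge0_integral_pushforward //= preimage_setT.
  have mhf : measurable_fun setT (h \o f) by exact: measurableT_comp.
  by rewrite -(repr_ge0 rnu).
- move=> h /integrableP[mh hoo]; rewrite E1 in hoo.
  have mhf : measurable_fun setT (h \o f) by exact: measurableT_comp.
  have ih : nu.-integrable setT (h \o f).
    apply/integrableP; split => //.
    move: hoo; rewrite ge0_integral_pushforward //= ?preimage_setT //.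
    exact: measurableT_comp.
  rewrite E1 integral_pushforward //= preimage_setT.
  by rewrite -(repr_integrable rnu).
- move=> d' S h mh.
  apply: (repr_measurable rnu (f := fun q => h (q.1, f q.2))).
  apply: (measurableT_comp mh).
  apply: measurable_fun_pair => //.
  exact: measurableT_comp.
Qed.

(** * Pointwise bounds for the layer kernel *)

(** For m > 0, 1 + v <= m (1 + v/m) <= m exp(v/m), hence (1 + v)^m <= m^m exp v; and v - v^2/4 <= 1
    because (v/2 - 1)^2 >= 0. *)
Lemma exprn_expR_le (R : realType) (m : nat) (v : R) : 0 <= v ->
  (1 + v) ^+ m * expR (- (v ^+ 2 / 4)) <= m%:R ^+ m * expR 1.
Proof.
move=> v0.
have H1 : (1 + v) ^+ m <= m%:R ^+ m * expR v.
  case: m => [|m]; first by rewrite !expr0 mul1r -expR0 ler_expR.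
  have m0 : (0 : R) < m.+1%:R by [].
  have -> : expR v = expR (v / m.+1%:R) ^+ m.+1.
    by rewrite -expRM_natr divfK // gt_eqF.
  rewrite -exprMn; apply: lerXn2r.
  - by rewrite nnegrE addr_ge0.
  - by rewrite nnegrE mulr_ge0 ?expR_ge0.
  apply: (@le_trans _ _ (m.+1%:R * (1 + v / m.+1%:R))).
    rewrite mulrDr mulr1 mulrCA divff ?gt_eqF // mulr1 lerD2r.
    by rewrite ler1n.
  by rewrite ler_pM2l // expR_ge1Dx.
apply: (@le_trans _ _ (m%:R ^+ m * expR v * expR (- (v ^+ 2 / 4)))).
  by rewrite ler_pM2r ?expR_gt0.
rewrite -mulrA -expRD; apply: ler_wpM2l; first exact: exprn_ge0.
rewrite ler_expR; have := sqr_ge0 (v / 2 - 1); rewrite !expr2; nra.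
Qed.

Lemma powR_opp_half (R : realType) (x : R) : 0 <= x ->
  powR x (- (1%:R / 2)) = (Num.sqrt x)^-1.
Proof. by move=> x0; rewrite powRN mul1r powR12_sqrt. Qed.

(* Everything is scaled by [r = sqrt s]: with [v = xi / r] and [w = 1 + 1 / r]
   the constraint [c <= xi + s] says exactly that [w] is at most linear in
   [v], so the Gaussian factor [exp (- v^2 / 4)] absorbs all powers of [w]. *)
Lemma dgauss1_bound (R : realType) (n : nat) (D c : R) : 1 <= D -> 0 < c ->
  exists2 C, 0 < C & forall a K Z xi s sigma : R,
    0 <= a <= n%:R -> 1 <= K -> 0 <= Z -> 0 <= xi -> 0 < s ->
    c <= xi + s -> Z <= D * (1 + xi) ->
    (forall u, 1 <= u -> 1 <= u * s -> K <= D * u * sigma) ->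
    powR sigma (- a) * - dgauss1 xi s * Z ^+ 2 <= C * powR K (- a).
Proof.
move=> D1 c0.
pose C1 := 2 + 2 / c.
have D0 : 0 < D by lra.
have C10 : 0 < C1 by rewrite /C1 addr_gt0 // divr_gt0.
(* Degree of w^(2n) v (w + v)^2 in 1 + v, once [w] is bounded by a multiple of 1 + v: w^(2n) comes
   from the power of [sigma], the rest from [dgauss1] and [Z ^+ 2]. *)
pose m := (n.*2 + 3)%N.
exists (D ^+ (n + 2) * (C1 + 1) ^+ (n.*2 + 2) * (m%:R ^+ m * expR 1)).
  have m0 : (0 : R) < m%:R by rewrite ltr0n /m addn_gt0 orbT.
  apply: mulr_gt0; last by rewrite mulr_gt0 ?exprn_gt0 ?expR_gt0.
  by apply: mulr_gt0; rewrite exprn_gt0 // addr_gt0.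
move=> a K Z xi s sigma /andP[a0 an] K1 Z0 xi0 s0 cs ZD Ksigma.
pose r := Num.sqrt s.
have r0 : 0 < r by rewrite sqrtr_gt0.
have rs : r ^+ 2 = s by rewrite sqr_sqrtr // ltW.
pose v := xi / r; pose w := 1 + r^-1.
have v0 : 0 <= v by rewrite divr_ge0 // ltW.
have ri0 : 0 < r^-1 by rewrite invr_gt0.
have w1 : 1 <= w by rewrite lerDl ltW.
have rw : r^-1 <= w by rewrite lerDr.
have xiE : xi = v * r by rewrite /v divfK // gt_eqF.
(* Either s >= c/2 and 1/r is bounded, or xi >= c/2 and 1/r = v/xi <= (2/c) v. *)
have wv : w <= C1 * (1 + v).
  have [sc|sc] := lerP (c / 2) s.
    have : r^-1 <= 1 + 2 / c.
      apply: (@le_trans _ _ (1 + r^-1 ^+ 2)).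
        by have := sqr_ge0 (r^-1 - 1); rewrite !expr2; nra.
      rewrite lerD2l exprVn rs -[2 / c]invrK invf_div.
      by rewrite lef_pV2 // posrE divr_gt0.
    have : 0 <= 2 / c by rewrite divr_ge0 // ltW.
    rewrite /w /C1; nra.
  have xc : c / 2 <= xi by lra.
  have : r^-1 <= 2 / c * v.
    rewrite /v mulrA -[leLHS]mul1r; apply: ler_wpM2r; first exact: ltW.
    by rewrite -(@ler_pM2l _ (c / 2)) ?divr_gt0 // mulrA mulrA divfK ?gt_eqF //
      mulr1 divff ?gt_eqF // mul1r.
  have : 0 <= 2 / c by rewrite divr_ge0 // ltW.
  rewrite /w /C1; nra.
have KD : K <= D * w ^+ 2 * sigma.
  (* The hypothesis is used with u = w^2, which is admissible since w^2 s = (w r)^2 = (r + 1)^2 >=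
     1. *)
  apply: Ksigma; first exact: exprn_ege1.
  rewrite -rs -exprMn exprn_ege1 //.
  by rewrite -(@mulVf _ r) ?gt_eqF // ler_pM2r.
have Dw1 : 1 <= D * w ^+ 2.
  by rewrite -[leLHS]mulr1 ler_pM // exprn_ege1.
have Dw0 : 0 < D * w ^+ 2 by rewrite (lt_le_trans ltr01).
have sigma0 : 0 < sigma.
  by rewrite -(pmulr_rgt0 _ Dw0) (lt_le_trans _ KD) // (lt_le_trans ltr01).
have K0 : 0 < K by rewrite (lt_le_trans ltr01).
have H1 : powR sigma (- a) <= (D * w ^+ 2) ^+ n * powR K (- a).
  rewrite !powRN ler_pdivlMr ?powR_gt0 // mulrC ler_pdivrMr ?powR_gt0 //.
  apply: (@le_trans _ _ (powR (D * w ^+ 2 * sigma) a)).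
    by rewrite ge0_ler_powR // nnegrE ltW // (lt_le_trans K0).
  rewrite powRM ?(ltW Dw0) ?(ltW sigma0) // ler_pM2r ?powR_gt0 //.
  rewrite -powR_mulrn ?(ltW Dw0) //; exact: ler_powR.
have H2 : - dgauss1 xi s * Z ^+ 2 <= D ^+ 2 * (v * (w + v) ^+ 2 * expR (- (v ^+ 2 / 4))).
  have E : - dgauss1 xi s <= v / s * expR (- (v ^+ 2 / 4)).
    rewrite /dgauss1 /gauss mulNr opprK.
    have -> : xi ^+ 2 / (4 * s) = v ^+ 2 / 4.
      rewrite /v -rs; field; lra.
    rewrite mulrA ler_pM2r ?expR_gt0 // powR_opp_half; last first.
      by rewrite !mulr_ge0 ?pi_ge0 // ltW.
    rewrite sqrtrM ?mulr_ge0 ?pi_ge0 // -/r invfM xiE -rs.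
    have P1 : (Num.sqrt (4 * pi))^-1 <= 1 :> R.
      rewrite invf_le1 ?sqrtr_gt0 ?mulr_gt0 ?pi_gt0 //.
      rewrite -[leLHS]sqrtr1 ler_wsqrtr //; have := pi_ge2 R; lra.
    have P0 : 0 < (Num.sqrt (4 * pi))^-1 :> R.
      by rewrite invr_gt0 sqrtr_gt0 mulr_gt0 // pi_gt0.
    have -> : v * r * (2^-1 / r ^+ 2) / (Num.sqrt (4 * pi) * r) =
       (v / r ^+ 2) * (2^-1 * (Num.sqrt (4 * pi))^-1).
      by field; rewrite !gt_eqF // sqrtr_gt0 mulr_gt0 // pi_gt0.
    apply: ler_piMr; first by rewrite divr_ge0 ?sqr_ge0.
    lra.
  apply: (@le_trans _ _ (v / s * expR (- (v ^+ 2 / 4)) * (D * (1 + xi)) ^+ 2)).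
    apply: ler_pM => //.
    - rewrite /dgauss1 mulNr opprK mulr_ge0 ?divr_ge0 ?mulr_ge0 ?powR_ge0 ?expR_ge0 //; lra.
    - exact: sqr_ge0.
    - by rewrite lerXn2r // nnegrE // (le_trans Z0).
  (* The singular factor 1/s is absorbed by the square, as (1 + xi)/r = 1/r + v. *)
  have -> : v / s * expR (- (v ^+ 2 / 4)) * (D * (1 + xi)) ^+ 2 =
    D ^+ 2 * (v * (r^-1 + v) ^+ 2 * expR (- (v ^+ 2 / 4))).
    rewrite -rs xiE; field; lra.
  rewrite ler_pM2l ?exprn_gt0 // ler_pM2r ?expR_gt0 //.
  apply: ler_wpM2l => //.
  by rewrite lerXn2r // ?nnegrE ?lerD2r //; lra.
have d0 : 0 <= - dgauss1 xi s.
  rewrite /dgauss1 mulNr opprK mulr_ge0 ?divr_ge0 ?mulr_ge0 ?powR_ge0 ?expR_ge0 //; lra.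
rewrite -mulrA; apply: (le_trans (ler_pM _ _ H1 H2)).
- exact: powR_ge0.
- by rewrite mulr_ge0 ?sqr_ge0.
rewrite mulrAC; apply: ler_wpM2r; first exact: powR_ge0.
set e := expR (- _).
have -> : (D * w ^+ 2) ^+ n * (D ^+ 2 * (v * (w + v) ^+ 2 * e)) =
  D ^+ (n + 2) * (w ^+ n.*2 * v * (w + v) ^+ 2 * e).
  by rewrite exprMn -exprM mul2n exprD; ring.
rewrite -[leRHS]mulrA.
apply: ler_wpM2l; first by rewrite exprn_ge0 // ltW.
apply: (@le_trans _ _ ((C1 + 1) ^+ (n.*2 + 2) * ((1 + v) ^+ m * expR (- (v ^+ 2 / 4))))); last first.
  apply: ler_wpM2l; first by rewrite exprn_ge0 // addr_ge0 // ltW.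
  exact: exprn_expR_le.
rewrite [leRHS]mulrA; apply: ler_wpM2r; first exact: expR_ge0.
have -> : (C1 + 1) ^+ (n.*2 + 2) * (1 + v) ^+ m =
  ((C1 + 1) * (1 + v)) ^+ n.*2 * (1 + v) * ((C1 + 1) * (1 + v)) ^+ 2.
  rewrite !exprMn /m !exprD; ring.
have w0 : 0 <= w by lra.
apply: ler_pM.
- by rewrite mulr_ge0 ?exprn_ge0.
- by rewrite sqr_ge0.
- apply: ler_pM => //.
  + exact: exprn_ge0.
  + apply: lerXn2r; rewrite ?nnegrE //; nra.
  + lra.
- apply: lerXn2r; rewrite ?nnegrE //; nra.
Qed.

Lemma heat_kernel_bound (R : realType) (n : nat) (eps delta Rr : R) :
  0 < eps -> 0 < delta -> 0 < Rr ->
  exists2 C, 0 < C & forall a k xN y tau t : R,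
    0 <= a <= n%:R -> 1 <= k -> 0 <= xN -> 0 <= y -> 0 <= tau < t ->
    Rr < xN + t ->
    powR ((t - tau) / eps + k / delta * tau) (- a)
      * - dgauss1 (xN + y + tau / delta) ((t - tau) / eps) * (1 + y + tau) ^+ 2
      <= C * powR (1 + k * tau) (- a).
Proof.
move=> e0 d0 R0.
(* With P = tau/delta and Q = (t - tau)/eps one has t = delta P + eps Q, so R < x_N + t <= (1 +
   delta + eps)(xi + Q): this gives the constant [c]. The factor 1 + delta gives both Z <= D (1 +
   xi) and 1 + k tau <= D u sigma, where u Q >= 1 pays for the summand 1. *)
have [|| C C0 HC] := @dgauss1_bound R n (1 + delta) (Rr / (1 + delta + eps)).
- lra.
- by rewrite divr_gt0 //; lra.
exists C => // a k xN y tau t an k1 xN0 y0 /andP[tau0 taut] Rt.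
have td0 : 0 <= tau / delta by rewrite divr_ge0 // ltW.
have te0 : 0 < (t - tau) / eps by rewrite divr_gt0 // subr_gt0.
have tdE : tau = tau / delta * delta by rewrite divfK // gt_eqF.
have teE : t - tau = (t - tau) / eps * eps by rewrite divfK // gt_eqF.
set P := tau / delta in td0 tdE *; set Q := (t - tau) / eps in te0 teE *.
have k0 : 0 <= k by lra.
apply: HC => //.
- by rewrite lerDl mulr_ge0.
- lra.
- lra.
- rewrite ler_pdivrMr; last lra.
  nra.
- nra.
- move=> u u1 us.
  have -> : k / delta * tau = k * P by rewrite /P mulrAC mulrA.
  have kP0 : 0 <= k * P by rewrite mulr_ge0.
  have -> : k * tau = k * P * delta by rewrite {1}tdE mulrA.
  set KP := k * P in kP0 *.
  have H1 : KP <= u * KP by rewrite ler_peMl.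
  have H2 : 0 <= (1 + delta) * (u * Q - 1) by rewrite mulr_ge0; lra.
  have H3 : 0 <= (1 + delta) * (u * KP - KP) by rewrite mulr_ge0; lra.
  nra.
Qed.

Lemma gauss_ge0 (R : realType) n (r2 t : R) : 0 <= gauss n r2 t.
Proof. by rewrite mulr_ge0 ?powR_ge0 ?expR_ge0. Qed.

Lemma dgauss1_le0 (R : realType) (xi t : R) : 0 <= xi -> 0 <= t ->
  dgauss1 xi t <= 0.
Proof.
move=> xi0 t0; rewrite /dgauss1 mulNr oppr_le0 mulr_ge0 ?gauss_ge0 //.
by rewrite divr_ge0 // mulr_ge0.
Qed.

(** At the endpoint tau = t the time argument is 0; the convention 1/0 = 0 makes the kernel vanish
    there, so the closed interval in [Hk] does no harm. *)
Lemma dgauss1_0 (R : realType) (xi : R) : dgauss1 xi 0 = 0.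
Proof. by rewrite /dgauss1 mulr0 invr0 mulr0 oppr0 mul0r. Qed.

Lemma gauss_le_powR (R : realType) n (r2 t : R) : 0 <= r2 -> 0 < t ->
  gauss n r2 t <= powR t (- (n%:R / 2)).
Proof.
move=> r0 t0; rewrite /gauss -[leRHS]mulr1; apply: ler_pM.
- exact: powR_ge0.
- exact: expR_ge0.
- rewrite !powRN lef_pV2 ?posrE ?powR_gt0 ?mulr_gt0 ?pi_gt0 //.
  rewrite ge0_ler_powR ?nnegrE ?divr_ge0 ?mulr_ge0 ?pi_ge0 ?(ltW t0) //.
  by apply: ler_peMl; [exact: ltW | have := pi_ge2 R; lra].
- by rewrite -expR0 ler_expR oppr_le0 divr_ge0 // mulr_ge0 // ltW.
Qed.

(** If z > A then (z/A)^(p-1) >= 1, so z <= A^(1-p) z^p. *)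
Lemma le_powR_trunc (R : realType) (p A z : R) : 1 <= p -> 0 < A -> 0 <= z ->
  z <= A + powR A (1 - p) * powR z p.
Proof.
move=> p1 A0 z0; have [zA|Az] := lerP z A.
  by apply: (le_trans zA); rewrite lerDl mulr_ge0 ?powR_ge0.
have z1 : 0 < z by exact: lt_trans Az.
apply: (@le_trans _ _ (powR A (1 - p) * powR z p)); last by rewrite lerDr ltW.
have -> : powR z p = z * powR z (p - 1) by rewrite mulr_powRB1 //; lra.
have -> : 1 - p = - (p - 1) by ring.
rewrite mulrCA ler_peMr // powRN mulrC ler_pdivlMr ?powR_gt0 // mul1r.
by rewrite ge0_ler_powR ?nnegrE ?(ltW A0) ?(ltW Az) //; lra.
Qed.

(** A crude bound, uniform in [tau], that makes [Hk] finite. The exponent a = n/2 (the case p = 1)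
    is the one for which sigma^(-a) dominates the tangential Gaussian. *)
Lemma gauss_dgauss1_bounded (R : realType) (n : nat) (eps delta Rr : R) :
  0 < eps -> 0 < delta -> 0 < Rr ->
  exists2 C, 0 < C & forall k xN y tau t r2 : R,
    1 <= k -> 0 <= xN -> 0 <= y -> 0 <= tau <= t ->
    Rr < xN + t -> 0 <= r2 ->
    gauss n r2 ((t - tau) / eps + k / delta * tau)
      * - dgauss1 (xN + y + tau / delta) ((t - tau) / eps) <= C.
Proof.
move=> e0 d0 R0.
have [C C0 HC] := heat_kernel_bound n e0 d0 R0.
exists C => // k xN y tau t r2 k1 xN0 y0 /andP[tau0].
rewrite le_eqVlt => /orP[/eqP ->|taut] Rt r20.
  by rewrite subrr mul0r dgauss1_0 oppr0 mulr0 ltW.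
have an : 0 <= (n%:R / 2 : R) <= n%:R.
  by rewrite divr_ge0 //=; have : (0 : R) <= n%:R by []; lra.
have := HC (n%:R / 2) k xN y tau t an k1 xN0 y0.
rewrite tau0 taut => /(_ isT Rt) H.
set dg := - dgauss1 _ _ in H *.
have dg0 : 0 <= dg.
  rewrite oppr_ge0 dgauss1_le0 ?addr_ge0 ?divr_ge0 ?(ltW e0) ?(ltW d0) //; lra.
set sg := (t - tau) / eps + _ in H *.
have sg0 : 0 < sg.
  rewrite /sg ltr_pwDl ?divr_gt0 ?subr_gt0 // !mulr_ge0 ?invr_ge0 ?(ltW d0) //; lra.
apply: (@le_trans _ _ (powR sg (- (n%:R / 2)) * dg)).
  by rewrite ler_wpM2r // gauss_le_powR.
have kt0 : 0 <= k * tau by rewrite mulr_ge0 //; lra.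
apply: (@le_trans _ _ (powR sg (- (n%:R / 2)) * dg * (1 + y + tau) ^+ 2)).
  rewrite ler_peMr ?mulr_ge0 ?powR_ge0 // exprn_ege1 //; lra.
apply: (le_trans H); rewrite ler_piMr ?(ltW C0) // powRN invf_le1.
  rewrite -[leLHS](powRr0 (1 + k * tau)) ler_powR ?divr_ge0 //; lra.
by rewrite powR_gt0 //; lra.
Qed.

(* Here [A = sigma^(-a) Z^(-1/p)] with [Z = 1 + y + tau] splits [z] as
   [z <= A + A^(1-p) z^p]; since [a p = n / 2], both terms of the split carry
   the same power [sigma^(-a)]. *)
Lemma gauss_dgauss1_split (R : realType) (n : nat) (p eps delta Rr : R) :
  1 <= p -> 0 < eps -> 0 < delta -> 0 < Rr ->
  let a := n%:R / (2 * p) in let q := 1 + (2 * p)^-1 in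
  exists2 C, 0 < C & forall k xN y tau t r2 z : R,
    1 <= k -> 0 <= xN -> 0 <= y -> 0 <= tau <= t ->
    Rr < xN + t -> 0 <= r2 -> 0 <= z ->
    gauss n r2 ((t - tau) / eps + k / delta * tau)
      * - dgauss1 (xN + y + tau / delta) ((t - tau) / eps) * z <=
    C * (powR (1 + k * tau) (- a) * powR (1 + tau) (- q))
      * (gauss n r2 ((t - tau) / eps + k / delta * tau) * powR (1 + y) (- q)
         + powR z p).
Proof.
move=> p1 e0 d0 R0 a q.
have [C C0 HC] := heat_kernel_bound n e0 d0 R0.
exists C => // k xN y tau t r2 z k1 xN0 y0 /andP[tau0].
have p0 : 0 < p by lra.
rewrite le_eqVlt => /orP[/eqP ->|taut] Rt r20 z0.
  rewrite subrr mul0r dgauss1_0 oppr0 mulr0 mul0r.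
  rewrite !mulr_ge0 ?(ltW C0) ?powR_ge0 // addr_ge0 ?powR_ge0 //.
  by rewrite mulr_ge0 ?gauss_ge0 ?powR_ge0.
have n0 : 0 <= n%:R :> R by [].
have ap : a * p = n%:R / 2 by rewrite /a; field; lra.
have an : 0 <= a <= n%:R.
  rewrite /a divr_ge0 ?mulr_ge0 ?(ltW p0) //= ler_pdivrMr ?mulr_gt0 //.
  by rewrite ler_peMr //; lra.
have := HC a k xN y tau t an k1 xN0 y0.
rewrite tau0 taut => /(_ isT Rt) H.
set dg := - dgauss1 _ _ in H *.
have dg0 : 0 <= dg.
  rewrite oppr_ge0 dgauss1_le0 ?addr_ge0 ?divr_ge0 ?(ltW e0) ?(ltW d0) //; lra.
set sg := (t - tau) / eps + _ in H *.
have sg0 : 0 < sg.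
  rewrite /sg ltr_pwDl ?divr_gt0 ?subr_gt0 // !mulr_ge0 ?invr_ge0 ?(ltW d0) //; lra.
set K := 1 + k * tau in H *; set Z := 1 + y + tau in H *.
have Z0 : 0 < Z by rewrite /Z; lra.
have {}H : powR sg (- a) * dg <= C * powR K (- a) * powR Z (- 2%:R).
  by rewrite powR_invn ?(ltW Z0) // ler_pdivlMr ?exprn_gt0.
set g := gauss _ _ _.
have g0 : 0 <= g by exact: gauss_ge0.
pose b := powR Z (- p^-1).
have b0 : 0 < b by rewrite powR_gt0.
pose A := powR sg (- a) * b.
have A0 : 0 < A by rewrite mulr_gt0 ?powR_gt0.
have Kq : 0 <= C * powR K (- a) by rewrite mulr_ge0 ?powR_ge0 ?(ltW C0).
have p20 : 0 < (2 * p)^-1 by rewrite invr_gt0 mulr_gt0.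
have p1E : p^-1 = (2 * p)^-1 + (2 * p)^-1 by field; lra.
have ZE r r' : powR Z (r + r') = powR Z r * powR Z r'.
  by rewrite powRD // (gt_eqF Z0) implybT.
have mono u v : 1 <= u -> u <= v -> powR v (- q) <= powR u (- q).
  move=> u1 uv; rewrite !powRN lef_pV2 ?posrE ?powR_gt0 //; [|lra|lra].
  by rewrite ge0_ler_powR ?nnegrE //; rewrite /q; lra.
have Zt : powR Z (- q) <= powR (1 + tau) (- q) by apply: mono; rewrite /Z; lra.
have Zy : powR Z (- q) <= powR (1 + y) (- q) by apply: mono; rewrite /Z; lra.
have T1 : g * dg * A <= C * powR K (- a) * (powR (1 + tau) (- q) * (g * powR (1 + y) (- q))).
  have -> : g * dg * A = powR sg (- a) * dg * (g * b) by rewrite /A; ring.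
  apply: (@le_trans _ _ (C * powR K (- a) * powR Z (- 2%:R) * (g * b))).
    by rewrite ler_wpM2r // mulr_ge0 // ltW.
  rewrite -[leLHS]mulrA ler_wpM2l //.
  have -> : powR Z (- 2%:R) * (g * b) = powR Z (- q) * (g * powR Z (- q)).
    rewrite /b mulrCA [RHS]mulrCA -!ZE; congr (_ * powR _ _).
    by rewrite p1E /q; ring.
  by rewrite ler_pM ?powR_ge0 ?mulr_ge0 ?powR_ge0 // ler_wpM2l.
have T2 : g * dg * (powR A (1 - p) * powR z p) <=
    C * powR K (- a) * (powR (1 + tau) (- q) * powR z p).
  rewrite !mulrA ler_wpM2r ?powR_ge0 //.
  apply: (@le_trans _ _ (powR sg (- (n%:R / 2)) * dg * powR A (1 - p))).
    by rewrite ler_wpM2r ?powR_ge0 // ler_wpM2r // gauss_le_powR.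
  have -> : powR sg (- (n%:R / 2)) * dg * powR A (1 - p) =
      powR sg (- a) * dg * powR Z (1 - p^-1).
    rewrite /A powRM ?powR_ge0 // -powRrM /b -powRrM.
    have -> : - p^-1 * (1 - p) = 1 - p^-1 by field; lra.
    rewrite [in RHS](_ : - a = - (n%:R / 2) + - a * (1 - p)); last first.
      by rewrite -ap; ring.
    by rewrite [powR sg (_ + _)]powRD ?(gt_eqF sg0) ?implybT //; ring.
  apply: (@le_trans _ _ (C * powR K (- a) * powR Z (- 2%:R) * powR Z (1 - p^-1))).
    by rewrite ler_wpM2r ?powR_ge0.
  rewrite -mulrA ler_wpM2l // -ZE.
  apply: le_trans Zt; apply: ler_powR; first by rewrite /Z; lra.
  by rewrite p1E /q; lra.
have zA := le_powR_trunc p1 A0 z0.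
apply: (@le_trans _ _ (g * dg * (A + powR A (1 - p) * powR z p))).
  by rewrite ler_wpM2l // mulr_ge0.
rewrite mulrDr; apply: (le_trans (lerD T1 T2)).
by rewrite -mulrDr -mulrDr !mulrA.
Qed.

(** * The one-dimensional integral that determines the rate *)

Lemma is_derive_powR_affine (R : realType) (k e x : R) : 0 < 1 + k * x ->
  is_derive x 1 (fun u : R => powR (1 + k * u) e)
    (e * k * powR (1 + k * x) (e - 1)).
Proof.
move=> kx0.
have Hp : is_derive (1 + k * x) 1 (@powR R ^~ e) (e * powR (1 + k * x) (e - 1)).
  have I : 1 + k * x \in `]0, +oo[ by rewrite in_itv/= andbT.
  split; first exact: (@derivable_powR R 1 e _ I).
  by rewrite -derive1E powR_derive1.
have Ha : is_derive x 1 (fun u : R => 1 + k * u) k.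
  by apply: is_derive_eq; rewrite add0r mul1r; exact: mulr1.
have := @is_derive1_comp _ (@powR R ^~ e) (fun u => 1 + k * u) x _ _ Hp Ha.
by rewrite mulrAC.
Qed.

Lemma continuous_powR_affine (R : realType) (k e x : R) : 0 < 1 + k * x ->
  {for x, continuous (fun u : R => powR (1 + k * u) e)}.
Proof.
move=> kx0; apply/differentiable_continuous/derivable1_diffP.
by have [] := is_derive_powR_affine e kx0.
Qed.

(** The exponent has the form e - 1 so that (1 + k x)^e / (e k) is an antiderivative; the
    logarithmic case e = 0 is [integral_inv_affine]. *)
Lemma integral_powR_affine (R : realType) (k e : R) : 0 < k -> e != 0 ->
  (\int[lebesgue_measure]_(x in `[0%R, 1%R]) (powR (1 + k * x) (e - 1))%R%:E =
   ((powR (1 + k) e - 1) / (e * k))%R%:E)%E.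
Proof.
move=> k0 e0.
pose F (x : R) := (e * k)^-1 * powR (1 + k * x) e.
have kx (x : R) : 0 <= x -> 0 < 1 + k * x.
  by move=> x0; rewrite ltr_wpDr // mulr_ge0 // ltW.
have dF (x : R) : 0 <= x -> is_derive x 1 F (powR (1 + k * x) (e - 1)).
  move=> x0; have H := is_derive_powR_affine e (kx _ x0).
  by apply: is_derive_eq; rewrite -[LHS]/(_ * _) mulrA mulVf ?mul1r // mulf_neq0 // gt_eqF.
have cF (x : R) : 0 <= x -> {for x, continuous F}.
  move=> x0; apply/differentiable_continuous/derivable1_diffP.
  by have [] := dF _ x0.
rewrite (@continuous_FTC2 _ _ F) //.
- rewrite /F mulr1 mulr0 addr0 powR1 mulr1 -EFinB; congr EFin.
  by rewrite [RHS]mulrC mulrBr mulr1.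
- apply: continuous_in_subspaceT => x; rewrite inE/= in_itv/= => /andP[x0 _].
  by apply: continuous_powR_affine; exact: kx.
- split.
  + by move=> x; rewrite in_itv/= => /andP[/ltW x0 _]; have [] := dF _ x0.
  + by apply: cvg_at_right_filter; exact: cF.
  + by apply: cvg_at_left_filter; exact: cF.
- move=> x; rewrite in_itv/= => /andP[/ltW x0 _].
  by rewrite derive1E; have [_ ->] := dF _ x0.
Qed.

Lemma integral_inv_affine (R : realType) (k : R) : 0 < k ->
  (\int[lebesgue_measure]_(x in `[0%R, 1%R]) (powR (1 + k * x) (- 1))%R%:E =
   (ln (1 + k) / k)%R%:E)%E.
Proof.
move=> k0.
pose F (x : R) := k^-1 * ln (1 + k * x).
have kx (x : R) : 0 <= x -> 0 < 1 + k * x.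
  by move=> x0; rewrite ltr_wpDr // mulr_ge0 // ltW.
have dF (x : R) : 0 <= x -> is_derive x 1 F (powR (1 + k * x) (- 1)).
  move=> x0.
  have Hl : is_derive (1 + k * x) 1 (@ln R) (1 + k * x)^-1.
    exact: is_derive1_ln (kx _ x0).
  have Ha : is_derive x 1 (fun u : R => 1 + k * u) k.
    by apply: is_derive_eq; rewrite add0r mul1r; exact: mulr1.
  have H := @is_derive1_comp _ (@ln R) (fun u => 1 + k * u) x _ _ Hl Ha.
  apply: is_derive_eq; rewrite -[LHS]/(_ * _) mulrCA mulVf ?gt_eqF // mulr1.
  by rewrite powR_inv1 // ltW // kx.
have cF (x : R) : 0 <= x -> {for x, continuous F}.
  move=> x0; apply/differentiable_continuous/derivable1_diffP.
  by have [] := dF _ x0.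
rewrite (@continuous_FTC2 _ _ F) //.
- rewrite /F mulr1 mulr0 addr0 ln1 mulr0 sube0; congr EFin.
  by rewrite mulrC.
- apply: continuous_in_subspaceT => x; rewrite inE/= in_itv/= => /andP[x0 _].
  by apply: continuous_powR_affine; exact: kx.
- split.
  + by move=> x; rewrite in_itv/= => /andP[/ltW x0 _]; have [] := dF _ x0.
  + by apply: cvg_at_right_filter; exact: cF.
  + by apply: cvg_at_left_filter; exact: cF.
- move=> x; rewrite in_itv/= => /andP[/ltW x0 _].
  by rewrite derive1E; have [_ ->] := dF _ x0.
Qed.

Lemma powR_affine_cvg0 (R : realType) (q : R) : 1 < q ->
  powR (1 + 1 * x) (1 - q) @[x --> +oo] --> (0 : R).
Proof.
move=> q1; apply/cvgrPdist_le => e e0; near=> x.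
rewrite sub0r normrN ger0_norm ?powR_ge0 // mul1r.
(* [A] is the solution of A^(1-q) = e. *)
pose A := powR e (- (q - 1)^-1).
have A0 : 0 < A by rewrite powR_gt0.
have Ax : A <= x by near: x; apply: nbhs_pinfty_ge; exact: num_real.
have -> : 1 - q = - (q - 1) by ring.
have eE : e = (powR A (q - 1))^-1.
  rewrite /A -powRrM mulNr mulVf ?powR_inv1 ?invrK ?(ltW e0) //.
  by rewrite gt_eqF // subr_gt0.
rewrite powRN [leRHS]eE lef_pV2 ?posrE ?powR_gt0 //; last by lra.
by rewrite ge0_ler_powR ?nnegrE //; lra.
Unshelve. all: by end_near. Qed.

Lemma integral_powR_tail (R : realType) (q : R) : 1 < q ->
  (\int[lebesgue_measure]_(x in `[0%R, +oo[) (powR (1 + x) (- q))%R%:E =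
   ((q - 1)^-1)%R%:E)%E.
Proof.
move=> q1.
pose F (x : R) := - (q - 1)^-1 * powR (1 + 1 * x) (1 - q).
have kx (x : R) : 0 <= x -> 0 < 1 + 1 * x by move=> x0; lra.
have dF (x : R) : 0 <= x -> is_derive x 1 F (powR (1 + x) (- q)).
  move=> x0; have H := is_derive_powR_affine (1 - q) (kx _ x0).
  apply: is_derive_eq; rewrite -[LHS]/(_ * _) mulr1 mulrA mul1r.
  have -> : 1 - q - 1 = - q by ring.
  rewrite -[RHS]mul1r; congr (_ * _); field; lra.
have cF (x : R) : 0 <= x -> {for x, continuous F}.
  move=> x0; apply/differentiable_continuous/derivable1_diffP.
  by have [] := dF _ x0.
rewrite (@ge0_continuous_FTC2y _ _ F _ 0) //.
- rewrite /F mulr0 addr0 powR1 mulr1 -EFinB; congr EFin.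
  by rewrite opprK add0r.
- by move=> x _; exact: powR_ge0.
- apply: continuous_in_subspaceT => x; rewrite inE/= in_itv/= andbT => x0.
  have := @continuous_powR_affine _ _ (- q) _ (kx _ x0).
  by rewrite (_ : (fun u : R => _) = (fun u => powR (1 + u) (- q))) //;
    apply/funext => u; rewrite mul1r.
- rewrite -[X in _ --> X](mulr0 (- (q - 1)^-1)).
  by apply: cvgM; [exact: cvg_cst | exact: powR_affine_cvg0].
- by move=> x /ltW x0; have [] := dF _ x0.
- by apply: cvg_at_right_filter; exact: cF.
- move=> x; rewrite in_itv/= andbT => /ltW x0.
  by rewrite derive1E; have [_ ->] := dF _ x0.
Qed.

(** Cut at x = 1. On [0, 1] the weight (1 + x)^(-q) is at most 1, and the integral of (1 + k x)^(-a)
    gives the three cases; beyond 1, (1 + k x)^(-a) <= k^(-a), which is of no larger order. Taking k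
    >= 2 keeps ln k away from 0. *)
Lemma decay_integral_bound (R : realType) (a q : R) : 0 < a -> 1 < q ->
  exists2 C, 0 < C & forall k : R, 2 <= k ->
    (\int[lebesgue_measure]_(x in `[0%R, +oo[)
       (powR (1 + k * x) (- a) * powR (1 + x) (- q))%R%:E <=
     (C * (if 1 < a then k^-1 else if a == 1 then k^-1 * ln k
           else powR k (- a)))%R%:E)%E.
Proof.
move=> a0 q1.
pose B (k : R) := if 1 < a then k^-1 else if a == 1 then k^-1 * ln k
           else powR k (- a).
have ln2 : 0 < ln (2 : R) by rewrite ln_gt0 // ltr1n.
have [C1 C10 H1] : exists2 C, 0 < C & forall k : R, 2 <= k ->
  (\int[lebesgue_measure]_(x in `[0%R, 1%R])
    (powR (1 + k * x) (- a))%R%:E <= (C * B k)%R%:E)%E.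
  have [a1|a1|a1] := ltgtP a 1.
  - have a1' : 0 < 1 - a by lra.
    exists (2 / (1 - a)); first by rewrite divr_gt0.
    move=> k k2; rewrite /B ltNge (ltW a1) /= (lt_eqF a1).
    have k0 : 0 < k by lra.
    have := @integral_powR_affine R k (1 - a) k0 (lt0r_neq0 a1').
    have aE : 1 - a - 1 = - a by ring.
    rewrite aE => ->.
    rewrite lee_fin ler_pdivrMr; last by rewrite mulr_gt0 //; lra.
    have -> : 2 / (1 - a) * powR k (- a) * ((1 - a) * k) =
       2 * (k * powR k (- a)) by field; lra.
    have -> : k * powR k (- a) = powR k (1 - a).
      by rewrite -[RHS]mulr_powRB1 ?aE //; lra.
    apply: (@le_trans _ _ (powR (1 + k) (1 - a))); first lra.
    apply: (@le_trans _ _ (powR (2 * k) (1 - a))).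
      by rewrite ge0_ler_powR ?nnegrE //; lra.
    rewrite powRM //; last lra.
    by rewrite ler_wpM2r ?powR_ge0 // ler1_powR //; lra.
  - have a1' : 0 < a - 1 by lra.
    exists (a - 1)^-1; first by rewrite invr_gt0.
    move=> k k2; rewrite /B a1.
    have k0 : 0 < k by lra.
    have a1n : 1 - a != 0 by lra.
    have := @integral_powR_affine R k (1 - a) k0 a1n.
    have aE : 1 - a - 1 = - a by ring.
    rewrite aE => ->.
    have -> : (powR (1 + k) (1 - a) - 1) / ((1 - a) * k) =
      (a - 1)^-1 * k^-1 * (1 - powR (1 + k) (1 - a)) by field; lra.
    rewrite lee_fin ler_piMr //.
      by rewrite mulr_ge0 ?invr_ge0 //; lra.
    by have := powR_ge0 (1 + k) (1 - a); lra.
  - exists 2 => // k k2; rewrite /B a1 ltxx eqxx.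
    rewrite integral_inv_affine; last lra.
    rewrite lee_fin mulrCA mulrC ler_wpM2l ?invr_ge0 //; first lra.
    (* For k >= 2 one has 1 + k <= k^2, hence ln(1 + k) <= 2 ln k. *)
    rewrite mulr_natl -lnXn; last lra.
    rewrite ler_ln ?posrE ?exprn_gt0 //; [|lra|lra].
    rewrite expr2; nra.
have B0 k : 2 <= k -> 0 <= B k.
  move=> k2; rewrite /B; case: ifP => _; first by rewrite invr_ge0; lra.
  case: ifP => _; last exact: powR_ge0.
  by rewrite mulr_ge0 ?invr_ge0 ?ln_ge0 //; lra.
have [C2 C20 H2] : exists2 C, 0 < C & forall k : R, 2 <= k -> powR k (- a) <= C * B k.
  have [a1|a1|a1] := ltgtP a 1.
  - by exists 1 => // k k2; rewrite /B ltNge (ltW a1) /= (lt_eqF a1) mul1r.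
  - exists 1 => // k k2; rewrite /B a1 mul1r -powR_inv1 ?ler_powR //; lra.
  - exists (ln 2)^-1; first by rewrite invr_gt0.
    move=> k k2; rewrite /B a1 ltxx eqxx powR_inv1; last lra.
    rewrite mulrCA ler_peMr ?invr_ge0 //; first lra.
    by rewrite mulrC ler_pdivlMr // mul1r ler_ln ?posrE //; lra.
exists (C1 + C2 * (q - 1)^-1).
  by rewrite addr_gt0 // mulr_gt0 // invr_gt0; lra.
move=> k k2; rewrite -/(B k).
have mpow (c e : R) (D : set R) :
    measurable_fun D (fun x : R => powR (1 + c * x) e).
  apply: measurable_funTS.
  apply: (@measurableT_comp _ _ _ _ _ _ (@powR R ^~ e)) => //.
  by apply: measurable_funD => //; exact: measurable_funM.
have mpow1 (e : R) (D : set R) :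
    measurable_fun D (fun x : R => powR (1 + x) e).
  apply: measurable_funTS.
  apply: (@measurableT_comp _ _ _ _ _ _ (@powR R ^~ e)) => //.
  exact: measurable_funD.
have mitv : measurable (`[0%R, 1%R]%classic : set R) by [].
have sub01 : `[0%R, 1%R]%classic `<=` (`[0%R, +oo[%classic : set R).
  by move=> x /=; rewrite !in_itv/= => /andP[-> _].
(* The tail majorant k^(-a) (1 + x)^(-q) is kept on the whole half-line, where its integral is
   explicit. *)
apply: (@le_trans _ _ (\int[lebesgue_measure]_(x in `[0%R, +oo[)
   (((fun x => (powR (1 + k * x) (- a))%R%:E) \_ `[0%R, 1%R]) x
     + (powR k (- a))%:E * (powR (1 + x) (- q))%R%:E))%E).
  apply: ge0_le_integral => //.
  - by move=> x _; rewrite lee_fin mulr_ge0 ?powR_ge0.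
  - by apply/measurable_EFinP; apply: measurable_funM; [exact: mpow | exact: mpow1].
  - apply: emeasurable_funD.
      apply: measurable_funTS; apply/(measurable_restrictT _ _).1 => //.
      by apply/measurable_EFinP; exact: mpow.
    by apply: measurable_funeM; apply/measurable_EFinP; exact: mpow1.
  - move=> x /=; rewrite in_itv/= andbT => x0.
    rewrite patchE; case: ifPn => [xI|xI].
      apply: (@le_trans _ _ ((powR (1 + k * x) (- a))%R%:E)).
        rewrite lee_fin ler_piMr ?powR_ge0 // powRN invf_le1 ?powR_gt0 //; last lra.
        rewrite -[leLHS](powRr0 (1 + x)) ler_powR //; lra.
      by rewrite leeDl // lee_fin mulr_ge0 ?powR_ge0.
    rewrite add0e lee_fin ler_wpM2r ?powR_ge0 //.
    have x1 : 1 < x.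
      rewrite ltNge; apply: contra xI => x1.
      by rewrite inE/= in_itv/= x0.
    rewrite !powRN lef_pV2 ?posrE ?powR_gt0 //; [|nra|lra].
    rewrite ge0_ler_powR ?nnegrE ?(ltW a0) //; nra.
rewrite ge0_integralD //; first last.
- by apply: measurable_funeM; apply/measurable_EFinP; exact: mpow1.
- by move=> x _; rewrite lee_fin mulr_ge0 ?powR_ge0.
- apply: measurable_funTS; apply/(measurable_restrictT _ _).1 => //.
  by apply/measurable_EFinP; exact: mpow.
- by move=> x _; rewrite patchE; case: ifP => // _; rewrite lee_fin powR_ge0.
rewrite -integral_mkcondr setIidr // ge0_integralZl_EFin ?powR_ge0 //; first last.
- apply/measurable_EFinP; exact: mpow1.
- by move=> x _; rewrite lee_fin powR_ge0.
rewrite integral_powR_tail // mulrDl EFinD leeD ?H1 // -EFinM lee_fin.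
by rewrite mulrAC ler_wpM2r ?invr_ge0 ?H2 //; lra.
Qed.

(** * Mass and measurability of the Gaussian kernels *)

Lemma gaussSn (R : realType) n (r r' s : R) : 0 < s ->
  gauss n.+1 (r + r') s = gauss 1 r s * gauss n r' s.
Proof.
move=> s0; rewrite /gauss mulrACA -expRD -powRD; last first.
  by rewrite (_ : 4 * pi * s == 0 = false) ?implybT // gt_eqF // !mulr_gt0 ?pi_gt0.
congr (powR _ _ * expR _).
  by rewrite -natr1; field.
by field; rewrite gt_eqF.
Qed.

(** Gamma_1(., s) is the normal density of variance 2s. *)
Lemma integral_gauss1 (R : realType) (x s : R) : 0 < s ->
  (\int[lebesgue_measure]_y (gauss 1 ((x - y) ^+ 2) s)%:E = 1)%E.
Proof.
move=> s0; pose sg : R := Num.sqrt (2 * s).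
have sg0 : sg != 0 by rewrite gt_eqF // sqrtr_gt0 mulr_gt0.
have sgE : sg ^+ 2 = 2 * s by rewrite sqr_sqrtr // mulr_ge0 // ltW.
rewrite -(integral_normal_pdf x sg); apply: eq_integral => y _.
rewrite normal_pdfE // /gauss /normal_peak /normal_fun sgE powR_opp_half; last first.
  by rewrite !mulr_ge0 ?pi_ge0 // ltW.
congr (EFin (_^-1 * expR _)).
  by congr Num.sqrt; rewrite -mulr_natr; ring.
rewrite -mulr_natr; field; lra.
Qed.

Lemma dist2_cons (R : realType) n (x : n.+1.-tuple R) (y : R) (v : n.-tuple R) :
  dist2 x (cons_tuple y v) =
  (thead x - y) ^+ 2 + dist2 [tuple of behead x] v.
Proof.
rewrite /dist2 big_ord_recl; congr (_ + _).
apply: eq_bigr => i _.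
by rewrite [in LHS](tuple_eta x) !tnthS.
Qed.

Lemma dist2_ge0 (R : realType) n (x y : n.-tuple R) : 0 <= dist2 x y.
Proof. by apply: sumr_ge0 => i _; exact: sqr_ge0. Qed.

(** Measurability is inherited from [powR], which agrees with the inverse on nonnegative reals; of
    the positive and negative parts of x at least one is 0, and 1/0 = 0 removes it. *)
Lemma measurable_inv (R : realType) : measurable_fun setT (fun x : R => x^-1).
Proof.
rewrite (_ : (fun x => _) = fun x : R =>
  powR (Num.max x 0) (- 1) - powR (Num.max (- x) 0) (- 1)).
  apply: measurable_funB.
  - apply: (@measurableT_comp _ _ _ _ _ _ (@powR R ^~ (- 1))) => //.
    exact: measurable_maxr.
  - apply: (@measurableT_comp _ _ _ _ _ _ (@powR R ^~ (- 1))) => //.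
    by apply: measurable_maxr => //; exact: measurable_funN.
apply/funext => x; rewrite !powR_inv1 ?le_max ?lexx ?orbT //.
have [x0|x0|->] := ltgtP x 0.
- by rewrite max_l ?oppr_ge0 ?(ltW x0) // invr0 sub0r invrN opprK.
- by rewrite max_r ?oppr_le0 ?(ltW x0) // invr0 subr0.
- by rewrite oppr0 maxxx invr0 subr0.
Qed.

Lemma measurable_funV d (T : measurableType d) (R : realType) (f : T -> R) :
  measurable_fun setT f -> measurable_fun setT (fun z => (f z)^-1).
Proof.
by move=> mf; apply: (@measurableT_comp _ _ _ _ _ _ (fun x : R => x^-1) _ f) => //;
  exact: measurable_inv.
Qed.

Lemma measurable_gauss d (T : measurableType d) (R : realType) n (f g : T -> R) :
  measurable_fun setT f -> measurable_fun setT g ->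
  measurable_fun setT (fun z => gauss n (f z) (g z)).
Proof.
move=> mf mg; rewrite /gauss; apply: measurable_funM.
  apply: (@measurableT_comp _ _ _ _ _ _ (@powR R ^~ _)) => //.
  exact: measurable_funM.
apply: measurableT_comp => //; apply: measurable_funN; apply: measurable_funM => //.
by apply: measurable_funV; exact: measurable_funM.
Qed.

Lemma measurable_dgauss1 d (T : measurableType d) (R : realType) (f g : T -> R) :
  measurable_fun setT f -> measurable_fun setT g ->
  measurable_fun setT (fun z => dgauss1 (f z) (g z)).
Proof.
move=> mf mg; rewrite /dgauss1; apply: measurable_funM.
  apply: measurable_funN; apply: measurable_funM => //.
  by apply: measurable_funV; exact: measurable_funM.
by apply: measurable_gauss => //; exact: measurable_funX.
Qed.

Lemma measurable_dist2 d (T : measurableType d) (R : realType) n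
  (x : n.-tuple R) (Y : T -> n.-tuple R) :
  measurable_fun setT Y -> measurable_fun setT (fun z => dist2 x (Y z)).
Proof.
move=> mY; rewrite /dist2; apply: measurable_sum => i.
apply: measurable_funX; apply: measurable_funB => //.
apply: (measurableT_comp (measurable_tnth i) mY).
Qed.

(** The Gaussian factors over the coordinates; constants are pulled out of [iint] through its
    representing measure. *)
Lemma iint_gauss (R : realType) n (x : n.-tuple R) (s : R) : 0 < s ->
  iint (fun y => (gauss n (dist2 x y) s)%:E) = 1%E.
Proof.
move=> s0; elim: n x => [|n IHn] x /=.
  by rewrite /gauss /dist2 big_ord0 mul0r oppr0 powRr0 mul0r oppr0 expR0 mulr1.
rewrite -(integral_gauss1 (thead x) s0); apply: eq_integral => y _.
have [mu rmu] := integral_repr_iint R n.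
have mg : measurable_fun setT
    (fun v => (gauss n (dist2 [tuple of behead x] v) s)%:E).
  apply/measurable_EFinP; apply: measurable_gauss => //.
  exact: measurable_dist2.
rewrite (_ : (fun v => _) = fun v => ((gauss 1 ((thead x - y) ^+ 2) s)%:E *
   (gauss n (dist2 [tuple of behead x] v) s)%:E)%E); last first.
  by apply/funext => v; rewrite dist2_cons gaussSn // EFinM.
have g0 v : (0 <= (gauss n (dist2 [tuple of behead x] v) s)%:E)%E.
  by rewrite lee_fin gauss_ge0.
rewrite (repr_ge0 rmu); last 2 first.
- exact: measurable_funeM.
- by move=> v; rewrite mule_ge0 // lee_fin gauss_ge0.
rewrite ge0_integralZl_EFin ?gauss_ge0 //.
by rewrite -(repr_ge0 rmu) // IHn mule1.
Qed.

(** * The layer kernel H and its integral estimate *)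

(** The point ranges over a measurable map [Y] so that the same lemmas serve the domain ([Y] the
    identity) and its boundary ([Y] sending y' to (y', 0)). *)
Lemma measurable_tangential_kernel d (T : measurableType d) (R : realType) N
  (eps delta k t : R) (x : pt R N) (Y : T -> pt R N) :
  measurable_fun setT Y ->
  measurable_fun setT (fun u : T * R =>
    gauss N.-1 (dist2 x.1 (Y u.1).1) ((t - u.2) / eps + k / delta * u.2)).
Proof.
move=> mY; apply: measurable_gauss.
  have m1 : measurable_fun setT (fun u : T * R => (Y u.1).1).
    by do 2 apply: measurableT_comp => //.
  exact: measurable_dist2.
apply: measurable_funD; last exact: measurable_funM.
by apply: measurable_funM => //; exact: measurable_funB.
Qed.

Lemma measurable_layer_kernel d (T : measurableType d) (R : realType) N
  (eps delta k t : R) (x : pt R N) (Y : T -> pt R N) :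
  measurable_fun setT Y ->
  measurable_fun setT (fun u : T * R =>
    gauss N.-1 (dist2 x.1 (Y u.1).1) ((t - u.2) / eps + k / delta * u.2)
    * dgauss1 (x.2 + (Y u.1).2 + u.2 / delta) ((t - u.2) / eps)).
Proof.
move=> mY; apply: measurable_funM; first exact: measurable_tangential_kernel.
have m2 : measurable_fun setT (fun u : T * R => (Y u.1).2).
  apply: (@measurableT_comp _ _ _ _ _ _ snd) => //.
  exact: measurableT_comp.
apply: measurable_dgauss1.
  by apply: measurable_funD; [exact: measurable_funD | exact: measurable_funM].
by apply: measurable_funM => //; exact: measurable_funB.
Qed.

Lemma set_itvccE (R : realType) (t : R) :
  [set tau : R | (0 <= tau <= t)%R] = `[0%R, t]%classic.
Proof. by apply/seteqP; split => x /=; rewrite in_itv. Qed.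

Lemma measurable_Hk d (T : measurableType d) (R : realType) N
  (eps delta k t : R) (x : pt R N) (Y : T -> pt R N) :
  measurable_fun setT Y ->
  measurable_fun setT (fun z => Hk eps delta k x (Y z) t).
Proof.
move=> mY; rewrite /Hk; apply: measurable_funeM.
under eq_fun do rewrite set_itvccE integral_mkcond.
pose h (u : T * R) := (gauss N.-1 (dist2 x.1 (Y u.1).1)
    ((t - u.2) / eps + k / delta * u.2)
    * dgauss1 (x.2 + (Y u.1).2 + u.2 / delta) ((t - u.2) / eps))%:E.
have mh : measurable_fun setT h.
  by apply/measurable_EFinP; exact: measurable_layer_kernel.
pose I : set R := `[0%R, t]%classic.
have mI : measurable ([set: T] `*` I).
  by apply: measurableX => //; exact: measurable_itv.
have := @measurable_fun_integral_param _ _ T _ R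
  (@lebesgue_measure R)
  (h \_ ([set: T] `*` I)).
have -> : (fun s => \int[@lebesgue_measure R]_u (h \_ ([set: T] `*` I)) (s, u))%E
  = (fun z => \int[@lebesgue_measure R]_u ((fun tau => h (z, tau)) \_ I) u)%E.
  apply/funext => z; apply: eq_integral => tau _.
  by rewrite !patchE in_setX /= in_setT.
apply; apply/(measurable_restrictT _ _).1 => //.
exact: measurable_funTS.
Qed.

(** Moving the sign onto [dgauss1] makes the integrand nonnegative, as Tonelli requires. *)
Lemma HkE (R : realType) N (eps delta k t : R) (x y : pt R N) :
  0 < eps -> 0 < delta -> 0 <= x.2 -> 0 <= y.2 ->
  Hk eps delta k x y t = (2%:E * \int[lebesgue_measure]_(tau in `[0%R, t])
    (gauss N.-1 (dist2 x.1 y.1) ((t - tau) / eps + k / delta * tau)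
     * - dgauss1 (x.2 + y.2 + tau / delta) ((t - tau) / eps))%R%:E)%E.
Proof.
move=> e0 d0 x0 y0; rewrite /Hk set_itvccE.
rewrite [in RHS](_ : 2%:E = (- (-2)%:E)%E); last by rewrite -EFinN opprK.
rewrite mulNe -muleN; congr (_ * _)%E.
rewrite -integral_ge0N.
  by apply: eq_integral => tau _; rewrite -EFinN mulrN opprK.
move=> tau; rewrite /= in_itv/= => /andP[tau0 taut].
rewrite lee_fin mulr_ge0 ?gauss_ge0 // oppr_ge0 dgauss1_le0 //.
  by rewrite !addr_ge0 // divr_ge0 // ltW.
by rewrite divr_ge0 ?subr_ge0 // ltW.
Qed.

Lemma Hk_ge0 (R : realType) N (eps delta k t : R) (x y : pt R N) :
  0 < eps -> 0 < delta -> 0 <= x.2 -> 0 <= y.2 ->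
  (0 <= Hk eps delta k x y t)%E.
Proof.
move=> e0 d0 x0 y0; rewrite HkE //; apply: mule_ge0 => //.
apply: integral_ge0 => tau; rewrite /= in_itv/= => /andP[tau0 taut].
rewrite lee_fin mulr_ge0 ?gauss_ge0 // oppr_ge0 dgauss1_le0 //.
  by rewrite !addr_ge0 // divr_ge0 // ltW.
by rewrite divr_ge0 ?subr_ge0 // ltW.
Qed.

Lemma Hk_fin_num (R : realType) N (eps delta k Rr t : R) (x y : pt R N) :
  0 < eps -> 0 < delta -> 0 < Rr -> 1 <= k -> inQ Rr x t -> 0 <= y.2 ->
  Hk eps delta k x y t \is a fin_num.
Proof.
move=> e0 d0 R0 k1 [x0 [t0 Rt]] y0.
rewrite ge0_fin_numE ?Hk_ge0 // HkE // lte_mul_pinfty //.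
have [C C0 HC] := gauss_dgauss1_bounded N.-1 e0 d0 R0.
have mk : measurable_fun `[0, t] (fun tau : R =>
    (gauss N.-1 (dist2 x.1 y.1) ((t - tau) / eps + k / delta * tau)
     * - dgauss1 (x.2 + y.2 + tau / delta) ((t - tau) / eps))%R%:E).
  apply: measurable_funTS; apply/measurable_EFinP.
  have mY : measurable_fun setT (fun _ : R => y) by exact: measurable_cst.
  have mp : measurable_fun setT (fun tau : R => (tau, tau)).
    exact: measurable_fun_pair.
  under eq_fun do rewrite mulrN.
  apply: measurable_funN.
  exact: (measurableT_comp (measurable_layer_kernel eps delta k t x mY) mp).
apply: (@le_lt_trans _ _ (\int[lebesgue_measure]_(tau in `[0%R, t]) (cst C%:E) tau)%E).
  apply: ge0_le_integral => //.
  - move=> tau; rewrite /= in_itv/= => /andP[tau0 taut].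
    rewrite lee_fin mulr_ge0 ?gauss_ge0 // oppr_ge0 dgauss1_le0 //.
      by rewrite !addr_ge0 // divr_ge0 // ltW.
    by rewrite divr_ge0 ?subr_ge0 // ltW.
  - move=> tau; rewrite /= in_itv/= => tauI.
    by rewrite lee_fin HC ?dist2_ge0.
rewrite integral_cst //= lebesgue_measure_itv /= lte_fin t0.
by rewrite -EFinB -EFinM ltry.
Qed.

(** In the domain [omega] is (1 + y_N)^(-q) and J = 1/(q - 1); on the boundary both are 1. As [J]
    does not depend on s, integrating over [z] before [tau] leaves a pure [tau] integral. The
    conditions on [Y] are asked only where [f] does not vanish, which admits functions extended by
    zero. *)
Lemma Hk_integral_bound (R : realType) (N : nat) (p eps delta Rr : R) :
  1 <= p -> 0 < eps -> 0 < delta -> 0 < Rr ->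
  let a := N.-1%:R / (2 * p) in let q := 1 + (2 * p)^-1 in
  exists2 C, 0 < C &
  forall d (T : measurableType d) (mu : {sigma_finite_measure set T -> \bar R})
    (Y : T -> pt R N) (omega f : T -> R) (J : R),
  measurable_fun setT Y -> measurable_fun setT omega -> measurable_fun setT f ->
  (forall z, 0 <= omega z) ->
  (forall z, f z != 0 ->
     0 <= (Y z).2 /\ powR (1 + (Y z).2) (- q) <= omega z) ->
  (forall x' s, 0 < s ->
     (\int[mu]_z (gauss N.-1 (dist2 x' (Y z).1) s * omega z)%R%:E <= J%:E)%E) ->
  forall k x t, 1 <= k -> inQ Rr x t ->
  (\int[mu]_z (Hk eps delta k x (Y z) t * (`|f z|)%:E) <=
   (\int[lebesgue_measure]_(tau in `[0%R, +oo[)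
      (powR (1 + k * tau) (- a) * powR (1 + tau) (- q))%R%:E) *
   (C%:E * (J%:E + \int[mu]_z (powR `|f z| p)%R%:E)))%E.
Proof.
move=> p1 e0 d0 R0 a q.
have [C C0 HC] := @gauss_dgauss1_split R N.-1 p eps delta Rr p1 e0 d0 R0.
exists (2 * C); first by rewrite mulr_gt0.
move=> d T mu Y omega f J mY mom mf om0 fY HJ k x t k1 [x0 [t0 Rt]].
pose m tau := powR (1 + k * tau) (- a) * powR (1 + tau) (- q).
pose g (u : T * R) :=
  gauss N.-1 (dist2 x.1 (Y u.1).1) ((t - u.2) / eps + k / delta * u.2).
pose I : set R := `[0%R, t]%classic.
have mI : measurable I by exact: measurable_itv.
have m0 tau : 0 <= m tau by rewrite mulr_ge0 ?powR_ge0.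
have mm (D : set R) : measurable_fun D m.
  apply: measurable_funTS; apply: measurable_funM.
    apply: (@measurableT_comp _ _ _ _ _ _ (@powR R ^~ (- a))) => //.
    by apply: measurable_funD => //; exact: measurable_funM.
  apply: (@measurableT_comp _ _ _ _ _ _ (@powR R ^~ (- q))) => //.
  exact: measurable_funD.
have mg : measurable_fun setT g 
  by exact: (measurable_tangential_kernel eps delta k t x mY).
have g0 u : 0 <= g u by exact: gauss_ge0.
pose Psi (u : T * R) := g u * omega u.1 + powR `|f u.1| p.
have mPsi : measurable_fun setT Psi.
  apply: measurable_funD.
    by apply: measurable_funM => //; exact: measurableT_comp.
  apply: (@measurableT_comp _ _ _ _ _ _ (@powR R ^~ p)) => //.
  apply: (@measurableT_comp _ _ _ _ _ _ (@Num.norm R R)) => //.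
  exact: measurableT_comp.
have Psi0 u : 0 <= Psi u.
  by apply: addr_ge0; [exact: mulr_ge0 | exact: powR_ge0].
(* The restriction to [0, t] becomes an indicator, so that Tonelli applies to a product of whole
   spaces. *)
pose Phi (u : T * R) := (\1_I u.2 * (m u.2 * Psi u))%:E.
have mPhi : measurable_fun setT Phi.
  apply/measurable_EFinP; apply: measurable_funM.
    exact: (@measurableT_comp _ _ _ _ _ _ (\1_I : R -> R) _ snd).
  by apply: measurable_funM => //; exact: measurableT_comp.
have mPsi0 tau u : 0 <= m tau * Psi u by exact: mulr_ge0.
have Phi0 u : (0 <= Phi u)%E.
  by rewrite lee_fin; apply: mulr_ge0 => //; rewrite indicE.
have PhiI z : (\int[lebesgue_measure]_tau Phi (z, tau) =
    \int[lebesgue_measure]_(tau in I) (m tau * Psi (z, tau))%:E)%E.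
  rewrite [RHS]integral_mkcond; apply: eq_integral => tau _.
  rewrite patchE /Phi /= indicE; case: (tau \in I) => /=.
    by rewrite mul1r.
  by rewrite mul0r.
have C20 : 0 <= 2 * C by rewrite mulr_ge0 // ltW.
have mPP z (D : set R) : measurable_fun D (fun tau => (m tau * Psi (z, tau))%:E).
  apply: measurable_funTS; apply/measurable_EFinP; apply: measurable_funM => //.
  exact: measurableT_comp.
have key z : (Hk eps delta k x (Y z) t * (`|f z|)%:E <=
    (2 * C)%:E * \int[lebesgue_measure]_tau Phi (z, tau))%E.
  have [fz0|fz] := eqVneq (f z) 0.
    by rewrite fz0 normr0 mule0 mule_ge0 // integral_ge0.
  have [y0 yom] := fY z fz.
  rewrite HkE // PhiI EFinM -!muleA; apply: lee_wpmul2l => //.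
  have dg0 tau : I tau -> 0 <= - dgauss1 (x.2 + (Y z).2 + tau / delta) ((t - tau) / eps).
    rewrite /I /= in_itv/= => /andP[tau0 taut].
    rewrite oppr_ge0 dgauss1_le0 //.
      by rewrite !addr_ge0 // divr_ge0 // ltW.
    by rewrite divr_ge0 ?subr_ge0 // ltW.
  have mk : measurable_fun I (fun tau : R =>
    (gauss N.-1 (dist2 x.1 (Y z).1) ((t - tau) / eps + k / delta * tau)
     * - dgauss1 (x.2 + (Y z).2 + tau / delta) ((t - tau) / eps))%R%:E).
    apply: measurable_funTS; apply/measurable_EFinP.
    have mp : measurable_fun setT (fun tau : R => (z, tau)).
      exact: measurable_fun_pair.
    under eq_fun do rewrite mulrN.
    apply: measurable_funN.
    exact: (measurableT_comp (measurable_layer_kernel eps delta k t x mY) mp).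
  rewrite -ge0_integralZr //; last first.
    by move=> tau tauI; rewrite lee_fin mulr_ge0 ?gauss_ge0 // dg0.
  rewrite -ge0_integralZl_EFin ?(ltW C0) //; first last.
  - exact: mPP.
  - by move=> tau _; rewrite lee_fin.
  apply: ge0_le_integral => //.
  - move=> tau tauI; apply: mule_ge0; rewrite lee_fin //.
    by apply: mulr_ge0; [exact: gauss_ge0 | exact: dg0].
  - exact: emeasurable_funM.
  - by apply: measurable_funeM; exact: mPP.
  - move=> tau tauI; rewrite -!EFinM lee_fin.
    have tau0t : 0 <= tau <= t by move: tauI; rewrite /I /= in_itv.
    apply: (le_trans (HC k x.2 (Y z).2 tau t _ _ k1 x0 y0 tau0t Rt
      (dist2_ge0 _ _) (normr_ge0 (f z)))).
    rewrite -mulrA -/a -/q -/(m tau) ler_wpM2l ?(ltW C0) // ler_wpM2l //.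
    by rewrite lerD2r ler_wpM2l // gauss_ge0.
set P := (\int[mu]_z (powR `|f z| p)%:E)%E.
have mfp : measurable_fun setT (fun z => (powR `|f z| p)%:E).
  apply/measurable_EFinP.
  apply: (@measurableT_comp _ _ _ _ _ _ (@powR R ^~ p)) => //.
  exact: measurableT_comp.
have P0 : (0 <= P)%E by apply: integral_ge0 => z _; rewrite lee_fin powR_ge0.
have J0 : (0 <= J%:E)%E.
  apply: le_trans (HJ x.1 1 ltr01).
  by apply: integral_ge0 => z _; rewrite lee_fin mulr_ge0 ?gauss_ge0.
have mHf : measurable_fun setT (fun z => Hk eps delta k x (Y z) t * (`|f z|)%:E)%E.
  apply: emeasurable_funM; first exact: measurable_Hk.
  by apply/measurable_EFinP; exact: measurableT_comp.
have mIPhi : measurable_fun setT (fun z => \int[lebesgue_measure]_tau Phi (z, tau))%E.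
  exact: (measurable_fun_fubini_tonelli_F (m2 := lebesgue_measure) Phi).
apply: (@le_trans _ _ (\int[mu]_z ((2 * C)%:E * \int[lebesgue_measure]_tau Phi (z, tau)))%E).
  apply: ge0_le_integral => //.
  - move=> z _; have [fz0|fz] := eqVneq (f z) 0.
      by rewrite fz0 normr0 mule0.
    by rewrite mule_ge0 // Hk_ge0 //; have [] := fY z fz.
  - exact: measurable_funeM.
rewrite ge0_integralZl_EFin //; last by move=> z _; exact: integral_ge0.
rewrite (fubini_tonelli (m1 := mu) (m2 := lebesgue_measure) Phi) //.
rewrite muleCA; apply: lee_wpmul2l => //.
apply: (@le_trans _ _ (\int[lebesgue_measure]_(tau in I) ((m tau)%:E * (J%:E + P)))%E).
  rewrite [leRHS]integral_mkcond; apply: ge0_le_integral => //.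
  - by move=> tau _; exact: integral_ge0.
  - exact: (measurable_fun_fubini_tonelli_G (m1 := mu) Phi).
  - apply/(measurable_restrictT _ _).1 => //.
    apply: emeasurable_funM => //.
    by apply/measurable_EFinP; exact: mm.
  - move=> tau _; rewrite patchE /Phi /= indicE; case: ifPn => tauI; last first.
      under eq_integral do rewrite mul0r.
      by rewrite integral0.
    have /andP[tau0 taut] : 0 <= tau <= t by move: tauI; rewrite inE /I /= in_itv.
    (* Also at tau = t: the surface diffusion term k t / delta is then positive. *)
    have sg0 : 0 < (t - tau) / eps + k / delta * tau.
      move: taut; rewrite le_eqVlt => /orP[/eqP tt|taut].
        by rewrite tt subrr mul0r add0r !mulr_gt0 ?invr_gt0 //; lra.
      rewrite ltr_pwDl ?divr_gt0 ?subr_gt0 // !mulr_ge0 ?invr_ge0 ?(ltW d0) //; lra.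
    under eq_integral do rewrite mul1r EFinM.
    rewrite ge0_integralZl_EFin //; last 2 first.
    + by move=> z _; rewrite lee_fin.
    + by apply/measurable_EFinP; apply: (measurableT_comp mPsi); exact: measurable_fun_pair.
    apply: lee_wpmul2l; first by rewrite lee_fin.
    rewrite /Psi /=; under eq_integral do rewrite EFinD.
    rewrite ge0_integralD //; last 2 first.
    + by move=> z _; rewrite lee_fin mulr_ge0.
    + apply/measurable_EFinP; apply: measurable_funM => //.
      by apply: (measurableT_comp mg); exact: measurable_fun_pair.
    by rewrite leeD2r //; exact: (HJ x.1 _ sg0).
rewrite ge0_integralZr //; last 3 first.
- by apply/measurable_EFinP; exact: mm.
- by move=> tau _; rewrite lee_fin.
- exact: adde_ge0.
apply: lee_wpmul2r; first exact: adde_ge0.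
(* Enlarging [0, t] to the half-line makes the bound uniform in t. *)
apply: ge0_subset_integral => //.
- by apply/measurable_EFinP; exact: mm.
- by move=> tau _; rewrite lee_fin.
- by move=> tau; rewrite /I /= !in_itv/= => /andP[-> _].
Qed.

(** The tangential Gaussian has mass 1 for every s > 0, so only the normal integral of [h]
    survives. *)
Lemma integral_gauss_tensor (R : realType) n
  (mu1 : {sigma_finite_measure set (n.-tuple R) -> \bar R})
  (mu : {sigma_finite_measure set (n.-tuple R * measurableTypeR R)%type -> \bar R})
  (h : R -> R) (c : R) (x' : n.-tuple R) (s : R) :
  integral_repr (@iint R n) mu1 ->
  (forall A, mu A = (mu1 \x @lebesgue_measure R)%E A) ->
  measurable_fun setT h -> (forall y, 0 <= h y) ->
  (\int[@lebesgue_measure R]_y (h y)%:E = c%:E)%E -> 0 < s ->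
  (\int[mu]_y (gauss n (dist2 x' y.1) s * h y.2)%R%:E = c%:E)%E.
Proof.
move=> r1 muE mh h0 hc s0.
have mg : measurable_fun setT (fun y : n.-tuple R => gauss n (dist2 x' y) s).
  by apply: measurable_gauss => //; exact: measurable_dist2.
pose F (y : n.-tuple R * measurableTypeR R) := (gauss n (dist2 x' y.1) s * h y.2)%:E.
have mF : measurable_fun setT F.
  apply/measurable_EFinP; apply: measurable_funM.
    exact: (measurableT_comp mg).
  exact: (measurableT_comp mh).
have F0 y : (0 <= F y)%E by rewrite lee_fin mulr_ge0 // gauss_ge0.
have -> : (\int[mu]_y F y = \int[mu1 \x @lebesgue_measure R]_y F y)%E.
  by apply: eq_measure_integral => A mA _; exact: muE.
rewrite fubini_tonelli1 // /fubini_F /F /=.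
under eq_integral => v _.
  under eq_integral do rewrite EFinM.
  rewrite ge0_integralZl_EFin ?gauss_ge0 //; first last.
  - exact/measurable_EFinP.
  - by move=> y _; rewrite lee_fin.
  rewrite hc.
  over.
have c0 : (0 <= c%:E)%E by rewrite -hc; apply: integral_ge0 => y _; rewrite lee_fin.
rewrite ge0_integralZr //; first last.
- by move=> y _; rewrite lee_fin gauss_ge0.
- exact/measurable_EFinP.
rewrite -(repr_ge0 r1) ?iint_gauss ?mul1e //.
- exact/measurable_EFinP.
- by move=> y; rewrite lee_fin gauss_ge0.
Qed.

(** * Integrability, and assembly of the estimate *)

(** Extension by zero turns the half-space into the full product space, for which a representing
    measure is available. *)
Lemma int_OmegaE (R : realType) N (f : pt R N -> \bar R) :
  int_Omega f = iint (fun y' => \int[lebesgue_measure]_yN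
    (f \_ [set y : pt R N | (0 < y.2)%R]) (y', yN))%E.
Proof.
rewrite /int_Omega; congr iint; apply/funext => y'.
rewrite integral_mkcond; apply: eq_integral => yN _.
by rewrite !patchE; congr (if _ then _ else _); apply/idP/idP; rewrite !inE.
Qed.

Lemma measurable_upper (R : realType) N :
  measurable [set y : pt R N | 0 < y.2].
Proof.
rewrite (_ : [set y | _] = [set: (N.-1).-tuple R] `*` `]0, +oo[%classic).
  by apply: measurableX => //; exact: measurable_itv.
by apply/seteqP; split => -[y' y] /=; rewrite in_itv/= andbT // => -[].
Qed.

Lemma fpE (R : realType) N (p k : R) : 0 < p ->
  (if 1 < N.-1%:R / (2 * p) then k^-1
   else if N.-1%:R / (2 * p) == 1 then k^-1 * ln k
   else powR k (- (N.-1%:R / (2 * p)))) = fp N p k.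
Proof.
move=> p0; rewrite /fp.
have -> : (1 < N.-1%:R / (2 * p)) = (p < N.-1%:R / 2).
  by rewrite ltr_pdivlMr ?mulr_gt0 // mul1r mulrC -ltr_pdivlMr.
have -> // : (N.-1%:R / (2 * p) == 1) = (p == N.-1%:R / 2).
have p20 : 2 * p != 0 by lra.
apply/eqP/eqP => H.
  have : (N.-1%:R : R) = 2 * p by rewrite -[LHS](divfK p20) H mul1r.
  lra.
have -> : (N.-1%:R : R) = 2 * p by lra.
by rewrite divff.
Qed.

(** The truncation inequality with A = 1 gives |g f| <= |g| + B |f|^p. *)
Lemma integrable_bounded_mul d (T : measurableType d) (R : realType)
  (mu : {measure set T -> \bar R}) (g f : T -> R) (B p : R) : 1 <= p ->
  measurable_fun setT g -> measurable_fun setT f ->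
  (forall z, `|g z| <= B) -> mu.-integrable setT (EFin \o g) ->
  (\int[mu]_z (powR `|f z| p)%:E < +oo)%E ->
  mu.-integrable setT (fun z => (g z * f z)%:E).
Proof.
move=> p1 mg mf gB ig fp.
have mfp : measurable_fun setT (fun z => (powR `|f z| p)%:E).
  apply/measurable_EFinP.
  apply: (@measurableT_comp _ _ _ _ _ _ (@powR R ^~ p)) => //.
  exact: measurableT_comp.
have i1 : mu.-integrable setT (fun z => (`|g z|)%:E).
  exact: (integrable_abse ig).
have i2 : mu.-integrable setT (fun z => (powR `|f z| p)%:E).
  apply/integrableP; split => //.
  by under eq_integral do rewrite gee0_abs ?lee_fin ?powR_ge0 //.
have := integrableD measurableT i1 (integrableZl measurableT B i2).
apply: le_integrable => //.
  by apply/measurable_EFinP; exact: measurable_funM.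
move=> z _; rewrite /= lee_fin normrM.
apply: (@le_trans _ _ (`|g z| + B * powR `|f z| p)); last exact: ler_norm.
have := le_powR_trunc p1 ltr01 (normr_ge0 (f z)).
rewrite powR1 mul1r => H.
apply: (le_trans (ler_wpM2l (normr_ge0 (g z)) H)).
by rewrite mulrDr mulr1 lerD2l ler_wpM2r ?powR_ge0.
Qed.

Lemma Hk_integrable (R : realType) N d (T : measurableType d)
  (mu : {measure set T -> \bar R}) (Y : T -> pt R N) (f : T -> R)
  (eps delta k t b : R) (x : pt R N) :
  0 < eps -> 0 < delta -> 0 <= x.2 ->
  measurable_fun setT Y -> measurable_fun setT f ->
  (forall z, f z != 0 -> 0 <= (Y z).2) ->
  (\int[mu]_z (Hk eps delta k x (Y z) t * (`|f z|)%:E) <= b%:E)%E ->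
  let F z := ((delta^-1)%:E * Hk eps delta k x (Y z) t * (f z)%:E)%E in
  mu.-integrable setT F /\ (`|\int[mu]_z F z| <= (delta^-1 * b)%:E)%E.
Proof.
move=> e0 d0 x0 mY mf fY Hb F.
have mH : measurable_fun setT (fun z => Hk eps delta k x (Y z) t).
  exact: measurable_Hk.
have mF : measurable_fun setT F.
  apply: emeasurable_funM; first exact: measurable_funeM.
  exact/measurable_EFinP.
have absF z : `|F z|%E = ((delta^-1)%:E * (Hk eps delta k x (Y z) t * (`|f z|)%:E))%E.
  rewrite /F -muleA abseM gee0_abs; last by rewrite lee_fin invr_ge0 ltW.
  congr (_ * _)%E; have [->|fz] := eqVneq (f z) 0.
    by rewrite normr0 !mule0 abse0.
  by rewrite abseM gee0_abs // Hk_ge0 // fY.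
have H0 z : (0 <= Hk eps delta k x (Y z) t * (`|f z|)%:E)%E.
  have [->|fz] := eqVneq (f z) 0; first by rewrite normr0 mule0.
  by rewrite mule_ge0 // Hk_ge0 // fY.
have Fb : (\int[mu]_z `|F z| <= (delta^-1 * b)%:E)%E.
  under eq_integral do rewrite absF.
  rewrite ge0_integralZl_EFin ?invr_ge0 ?(ltW d0) //.
    by rewrite EFinM; apply: lee_wpmul2l => //; rewrite lee_fin invr_ge0 ltW.
  apply: emeasurable_funM => //.
  by apply/measurable_EFinP; exact: measurableT_comp.
split.
  by apply/integrableP; split => //; rewrite (le_lt_trans Fb) ?ltry.
exact: le_trans (le_abse_integral _ _ _) Fb.
Qed.

(** Each Gaussian in [G0] is bounded and has finite mass. Integrability makes the integral defining
    z^D finite, so that it can be split off from u_k and cancelled. *)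
Lemma G0_integrable (R : realType) N
  (mu1 : {sigma_finite_measure set (N.-1.-tuple R) -> \bar R})
  (mu : {sigma_finite_measure set (N.-1.-tuple R * measurableTypeR R)%type -> \bar R})
  (x : pt R N) (s p : R) (f : pt R N -> R) :
  (0 < N)%N -> integral_repr (@iint R N.-1) mu1 ->
  (forall A, mu A = (mu1 \x @lebesgue_measure R)%E A) -> 0 < s -> 1 <= p ->
  measurable_fun setT f -> (\int[mu]_z (powR `|f z| p)%:E < +oo)%E ->
  mu.-integrable setT (fun y => (G0 x y s * f y)%:E).
Proof.
move=> N0 r1 muE s0 p1 mf fp.
(* Reflecting x instead of y writes both terms of [G0] as one Gaussian, centred at b = x_N and at b
   = -x_N. *)
pose G (b : R) (y : N.-1.-tuple R * measurableTypeR R) :=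
  gauss N (dist2 x.1 y.1 + (b - y.2) ^+ 2) s.
have mG b : measurable_fun setT (G b).
  apply: measurable_gauss => //; apply: measurable_funD.
    by apply: measurable_dist2.
  by apply: measurable_funX; apply: measurable_funB => //; exact: measurable_snd.
have iG b : mu.-integrable setT (EFin \o G b).
  apply/integrableP; split; first exact/measurable_EFinP.
  have mh : measurable_fun setT (fun y : R => gauss 1 ((b - y) ^+ 2) s).
    by apply: measurable_gauss => //; apply: measurable_funX; exact: measurable_funB.
  rewrite (_ : (\int[mu]_y _)%E = 1%:E) ?ltry //.
  rewrite -(integral_gauss_tensor x.1 r1 muE mh _ (integral_gauss1 b s0) s0); last first.
    by move=> y; exact: gauss_ge0.
  apply: eq_integral => y _; rewrite gee0_abs ?lee_fin ?gauss_ge0 //=.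
  have gaussN r r' : gauss N (r + r') s = gauss 1 r s * gauss N.-1 r' s.
    by case: (N) N0 => // n _; exact: gaussSn.
  by rewrite /G addrC gaussN mulrC.
have GE y : G0 x y s = G x.2 y - G (- x.2) y.
  by rewrite /G0 /G; congr (_ - gauss _ (_ + _) _); rewrite -opprD sqrrN.
have mG0 : measurable_fun setT (fun y : N.-1.-tuple R * measurableTypeR R => G0 x y s).
  by under eq_fun do rewrite GE; exact: measurable_funB.
apply: (@integrable_bounded_mul _ _ _ mu (fun y => G0 x y s) f (powR s (- (N%:R / 2))) p) => //.
- move=> y; rewrite GE.
  have H b : 0 <= G b y <= powR s (- (N%:R / 2)).
    rewrite gauss_ge0 gauss_le_powR // addr_ge0 ?sqr_ge0 //.
    exact: dist2_ge0.
  have := H x.2; have := H (- x.2); rewrite ler_norml; lra.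
- rewrite (_ : EFin \o _ = ((EFin \o G x.2) \- (EFin \o G (- x.2)%R))%E).
    exact: integrableB.
  by apply/funext => y /=; rewrite GE EFinB.
Qed.

Theorem theorem5p4 (R : realType) (N : nat) (hN : (2 <= N)%N)
  (p : R) (hp : 1 <= p)
  (phi : pt R N -> R) (psi : (N.-1).-tuple R -> R)
  (hphi : Lp_Omega p phi) (hpsi : Lp_bd p psi)
  (eps delta : R) (heps : 0 < eps) (hdelta : 0 < delta)
  (Rr : R) (hRr : 0 < Rr) :
  exists C K : R, forall k : R, 1 < k -> K < k ->
    forall (x : pt R N) (t : R), inQ Rr x t ->
      (`| u_k eps delta k phi psi x t - zD eps phi x t | <= (C * fp N p k)%:E)%E.
Proof.
have p0 : 0 < p by lra.
have N0 : (0 < N)%N by exact: ltn_trans hN.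
have n0 : (0 : R) < N.-1%:R by rewrite ltr0n -ltnS prednK.
pose a : R := N.-1%:R / (2 * p); pose q : R := 1 + (2 * p)^-1.
have a0 : 0 < a by rewrite divr_gt0 // mulr_gt0.
have q1 : 1 < q by rewrite ltrDl invr_gt0 mulr_gt0.
have [CM CM0 HM] := decay_integral_bound a0 q1.
have [C C0 HC] := @Hk_integral_bound R N p eps delta Rr hp heps hdelta hRr.
have [mu1 r1] := integral_repr_iint R N.-1.
have [mu2 [r2 mu2E]] := integral_repr_prod r1
  (integral_repr_integral (@lebesgue_measure R)).
pose D := [set y : pt R N | (0 < y.2)%R].
have mD : measurable D by exact: measurable_upper.
pose phi0 := phi \_ D.
have mphi0 : measurable_fun setT phi0.
  by apply/(measurable_restrictT _ _).1 => //; have [] := hphi.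
have phi0E y : (phi0 y)%:E = ((EFin \o phi) \_ D) y.
  by rewrite /phi0 !patchE; case: ifP.
pose P2 := (\int[mu2]_y (powR `|phi0 y| p)%:E)%E.
have P2oo : (P2 < +oo)%E.
  have [_] := hphi; rewrite int_OmegaE.
  rewrite (_ : _ \_ _ = fun y => (powR `|phi0 y| p)%:E).
    rewrite (repr_ge0 r2 (f := fun y => (powR `|phi0 y| p)%:E)) //.
    apply/measurable_EFinP.
    apply: (@measurableT_comp _ _ _ _ _ _ (@powR R ^~ p)) => //.
    exact: measurableT_comp.
  apply/funext => y; rewrite /phi0 !patchE; case: ifP => // _.
  by rewrite normr0 powR0 // gt_eqF.
pose P1 := (\int[mu1]_y (powR `|psi y| p)%:E)%E.
have mpsi : measurable_fun setT psi by have [] := hpsi.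
have P1oo : (P1 < +oo)%E.
  have [_] := hpsi; rewrite /int_bd (repr_ge0 r1) //.
  apply/measurable_EFinP.
  apply: (@measurableT_comp _ _ _ _ _ _ (@powR R ^~ p)) => //.
  exact: measurableT_comp.
have P20 : (0 <= P2)%E by apply: integral_ge0 => y _; rewrite lee_fin powR_ge0.
have P10 : (0 <= P1)%E by apply: integral_ge0 => y _; rewrite lee_fin powR_ge0.
have P2f : P2 = (fine P2)%:E by rewrite fineK // ge0_fin_numE.
have P1f : P1 = (fine P1)%:E by rewrite fineK // ge0_fin_numE.
pose J : R := (q - 1)^-1.
have J0 : 0 < J by rewrite invr_gt0 subr_gt0.
pose b2 := C * (J + fine P2); pose b1 := C * (1 + fine P1).
have b20 : 0 <= b2 by rewrite mulr_ge0 ?addr_ge0 ?fine_ge0 // ltW.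
have b10 : 0 <= b1 by rewrite mulr_ge0 ?addr_ge0 ?fine_ge0 // ltW.
(* The summands belong to the domain and to the boundary; delta^-1 is the factor of H in G, and 2 is
   the threshold of [decay_integral_bound]. *)
exists (delta^-1 * (CM * b2) + delta / eps * (delta^-1 * (CM * b1))), 2.
move=> k k1 k2 x t xQ.
have [x0 [t0 Rt]] := xQ.
have k1' : 1 <= k by exact: ltW.
have HMk := HM k (ltW k2); rewrite /a (fpE _ _ p0) in HMk.
have Jint : (\int[@lebesgue_measure R]_y
    (powR (1 + y) (- q) * \1_(`[0%R, +oo[%classic : set R) y)%R%:E = J%:E)%E.
  rewrite -(integral_powR_tail q1) [RHS]integral_mkcond.
  apply: eq_integral => y _; rewrite patchE indicE.
  by case: (y \in _); rewrite ?mulr1 ?mulr0.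
have mh : measurable_fun setT (fun y : R =>
    powR (1 + y) (- q) * \1_(`[0%R, +oo[%classic : set R) y).
  apply: measurable_funM => //.
  apply: (@measurableT_comp _ _ _ _ _ _ (@powR R ^~ (- q))) => //.
  exact: measurable_funD.
have h0 (y : R) : 0 <= powR (1 + y) (- q) * \1_(`[0%R, +oo[%classic : set R) y.
  by rewrite mulr_ge0 ?powR_ge0 // indicE.
have phi0D y : phi0 y != 0 -> 0 < y.2.
  rewrite /phi0 patchE; case: ifPn => [|_]; first by rewrite inE.
  by rewrite eqxx.
have H2 : (\int[mu2]_y (Hk eps delta k x y t * (`|phi0 y|)%:E) <=
    (CM * fp N p k * b2)%:E)%E.
  have := HC _ _ mu2 id
    (fun y => powR (1 + y.2) (- q) * \1_(`[0%R, +oo[%classic : set R) y.2)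
    phi0 J (@measurable_id _ _ _) (measurableT_comp mh measurable_snd) mphi0
    (fun y => h0 y.2).
  move=> /(_ _ _ _ _ _ k1' xQ) B2; apply: (le_trans (B2 _ _)).
  - move=> y /phi0D y0; split; first exact: ltW.
    by rewrite indicE mem_set ?mulr1 //= in_itv /= ltW.
  - move=> x' s s0.
    by rewrite (integral_gauss_tensor x' r1 mu2E mh h0 Jint s0).
  - rewrite -/P2 P2f -EFinD -EFinM -/b2 [leRHS]EFinM; apply: lee_wpmul2r => //.
have H1 : (\int[mu1]_y (Hk eps delta k x (y, 0%R) t * (`|psi y|)%:E) <=
    (CM * fp N p k * b1)%:E)%E.
  have mY : measurable_fun setT (fun y : N.-1.-tuple R => ((y, 0) : pt R N)).
    exact: measurable_fun_pair.
  have := HC _ _ mu1 (fun y => (y, 0)) (fun=> 1) psi 1 mY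
    (measurable_cst _) mpsi (fun=> ler01).
  move=> /(_ _ _ _ _ _ k1' xQ) B1; apply: (le_trans (B1 _ _)).
  - by move=> y _; split => //=; rewrite addr0 powR1.
  - move=> x' s s0; under eq_integral do rewrite mulr1.
    rewrite -(repr_ge0 r1) ?iint_gauss //.
    + apply/measurable_EFinP; apply: measurable_gauss => //.
      exact: (measurable_dist2 x' (@measurable_id _ _ _)).
    + by move=> y; rewrite lee_fin gauss_ge0.
  - rewrite -/P1 P1f -EFinD -EFinM -/b1 [leRHS]EFinM; apply: lee_wpmul2r => //.
have [iB2 B2le] := @Hk_integrable R N _ _ mu2 id phi0 eps delta k t _ x
  heps hdelta x0 (@measurable_id _ _ _) mphi0
  (fun y yn0 => ltW (phi0D y yn0)) H2.
have mY : measurable_fun setT (fun y : N.-1.-tuple R => ((y, 0) : pt R N)).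
  exact: measurable_fun_pair.
have [iB1 B1le] := @Hk_integrable R N _ _ mu1 (fun y => (y, 0)) psi eps delta k t _ x
  heps hdelta x0 mY mpsi (fun _ _ => lexx 0) H1.
have te0 : 0 < t / eps by rewrite divr_gt0.
have iA := G0_integrable x N0 r1 mu2E te0 hp mphi0 P2oo.
have zE : zD eps phi x t = (\int[mu2]_y (G0 x y (t / eps) * phi0 y)%:E)%E.
  rewrite /zD int_OmegaE -(repr_integrable r2 iA); congr iint.
  apply/funext => y'; apply: eq_integral => y _.
  rewrite /phi0 !patchE; case: ifP => _; first by rewrite EFinM.
  by rewrite mulr0.
have uE : u_k eps delta k phi psi x t =
  (\int[mu2]_y (G0 x y (t / eps) * phi0 y)%:E +
   \int[mu2]_y ((delta^-1)%:E * Hk eps delta k x y t * (phi0 y)%:E) +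
   (delta / eps)%:E * \int[mu1]_y ((delta^-1)%:E * Hk eps delta k x (y, 0%R) t * (psi y)%:E))%E.
  rewrite /u_k; congr (_ + _ * _)%E.
    rewrite -integralD // -(repr_integrable r2 (integrableD measurableT iA iB2)) int_OmegaE.
    congr iint; apply/funext => y'; apply: eq_integral => y _.
    rewrite /= /phi0 !patchE; case: ifPn => [yD|_]; last first.
      by rewrite mulr0 mule0 adde0.
    have y0 : 0 <= y by move: yD; rewrite inE => /ltW.
    (* Distributing the factor [phi] over the sum [Gk] of extended reals is justified by finiteness
       of H. *)
    have Hf := Hk_fin_num (y := (y', y)) heps hdelta hRr k1' xQ y0.
    rewrite /Gk muleDl ?EFinM //; exact: fin_num_adde_defr.
  rewrite /int_bd -(repr_integrable r1 iB1); congr iint.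
  apply/funext => y'; rewrite /Gk /G0 /= subr0 addr0 subrr add0e //.
rewrite uE zE.
have Af := integrable_fin_num measurableT iA.
have B2f := integrable_fin_num measurableT iB2.
have B1f := integrable_fin_num measurableT iB1.
(* Cancelling z^D is legitimate since [Af] makes it finite. *)
rewrite -[X in (X - _)%E]addeA [X in (X - _)%E]addeC addeK //.
apply: (le_trans (lee_abs_add _ _)).
rewrite mulrDl EFinD; apply: leeD.
  apply: (le_trans B2le); rewrite lee_fin le_eqVlt; apply/orP; left; apply/eqP.
  by ring.
rewrite abseM gee0_abs ?lee_fin ?divr_ge0 ?(ltW hdelta) ?(ltW heps) //.
apply: (@le_trans _ _ ((delta / eps)%:E * (delta^-1 * (CM * fp N p k * b1))%:E)%E).
  by apply: lee_wpmul2l => //; rewrite lee_fin divr_ge0 // ltW.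
rewrite -EFinM lee_fin le_eqVlt; apply/orP; left; apply/eqP.
by ring.
Qed.
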